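(* There are scattered C*-algebras which are not AU; in particular, they are not AF.
   Context: A C*-algebra $A$ is scattered if every nonzero quotient $B$ of $A$ contains a nonzero minimal projection, i.e. a nonzero projection $p$ with $pBp=\mathbb{C}p$ (equivalently, every self-adjoint element of $A$ has countable spectrum). $A$ is approximately finite-dimensional (AF) if it has a family of finite-dimensional C*-subalgebras, directed under inclusion, with dense union. $A$ is almost unital (AU) if it has a family of unital C*-subalgebras, directed under inclusion, with dense union; a unital C*-subalgebra $B\subseteq A$ is one having its own unit $1_B$, not necessarily a unit of $A$. The statement is a theorem of ZFC. *)

(* Defs.v *)
From HB Require Import structures.
From mathcomp Require Import all_boot all_order all_algebra.
From mathcomp Require Import complex.
From mathcomp Require Import boolp classical_sets reals topology normedtype.

Set Implicit Arguments.
Unset Strict Implicit.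
Unset Printing Implicit Defensive.

Import Order.TTheory GRing.Theory Num.Theory.
Import numFieldNormedType.Exports.

Local Open Scope classical_set_scope.
Local Open Scope ring_scope.
Local Open Scope complex_scope.

(* C*-algebras are not assumed unital (a unital one is trivially almost
   unital), so the product cannot come from MathComp's ring structures, which
   all carry a unit. Norms take values in R[i], where they are
   nonnegative reals. *)
HB.mixin Record CompleteNormedModule_isCStarAlgebra (R : realType) A
    of CompleteNormedModule R[i] A := {
  cmul : A -> A -> A;
  star : A -> A;
  cmulA : associative cmul;
  cmulDl : left_distributive cmul +%R;
  cmulDr : right_distributive cmul +%R;
  cscalerAl : forall (k : R[i]) (a b : A), k *: cmul a b = cmul (k *: a) b;
  cscalerAr : forall (k : R[i]) (a b : A), k *: cmul a b = cmul a (k *: b);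
  starK : involutive star;
  starD : {morph star : a b / a + b};
  starZ : forall (k : R[i]) (a : A), star (k *: a) = k^* *: star a;
  starM : forall a b : A, star (cmul a b) = cmul (star b) (star a);
  cnormM : forall a b : A, `|cmul a b| <= `|a| * `|b|;
  cnorm_star : forall a : A, `|cmul (star a) a| = `|a| ^+ 2
}.

#[short(type="cstarAlgType")]
HB.structure Definition CStarAlgebra (R : realType) :=
  { A of CompleteNormedModule_isCStarAlgebra R A
       & CompleteNormedModule R[i] A }.

Arguments cmul {R A} a b : rename.
Arguments star {R A} a : rename.

Reserved Notation "a ** b" (at level 40, left associativity).
Notation "a ** b" := (cmul a b) : ring_scope.

Record closed_ideal (R : realType) (A : cstarAlgType R) (I : set A) : Prop := {
  closed_ideal_closed : closed I;
  closed_ideal0 : I 0;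
  closed_idealD : forall a b, I a -> I b -> I (a + b);
  closed_idealZ : forall (k : R[i]) a, I a -> I (k *: a);
  closed_idealMl : forall a b, I b -> I (a ** b);
  closed_idealMr : forall a b, I a -> I (a ** b)
}.

Record star_hom (R : realType) (A B : cstarAlgType R) (f : A -> B) : Prop := {
  star_homD : forall a b, f (a + b) = f a + f b;
  star_homZ : forall (k : R[i]) a, f (k *: a) = k *: f a;
  star_homM : forall a b, f (a ** b) = f a ** f b;
  star_homS : forall a, f (star a) = star (f a)
}.

(* pi exhibits B as the quotient C*-algebra A / I; the last two fields say that
   `|pi a| is the quotient norm inf {`|a + x| : x in I}. *)
Record quotient_map (R : realType) (A B : cstarAlgType R) (I : set A)
    (pi : A -> B) : Prop := {
  quotient_map_hom : star_hom pi;
  quotient_map_surj : forall b, exists a, pi a = b;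
  quotient_map_ker : forall a, pi a = 0 <-> I a;
  quotient_map_norm_le : forall a x, I x -> `|pi a| <= `|a + x|;
  quotient_map_norm_inf : forall a (e : R[i]), 0 < e ->
    exists2 x, I x & `|a + x| < `|pi a| + e
}.

Definition quotient_of (R : realType) (A B : cstarAlgType R) : Prop :=
  exists (I : set A) (pi : A -> B), closed_ideal I /\ quotient_map I pi.

Definition projection (R : realType) (A : cstarAlgType R) (p : A) : Prop :=
  star p = p /\ p ** p = p.

Definition minimal_projection (R : realType) (A : cstarAlgType R) (p : A) :
    Prop :=
  [/\ projection p, p != 0 &
    [set p ** b ** p | b in [set: A]] = [set k *: p | k in [set: R[i]]]].

Definition scattered (R : realType) (A : cstarAlgType R) : Prop :=
  forall B : cstarAlgType R, quotient_of A B -> (exists b : B, b != 0) ->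
    exists p : B, minimal_projection p.

Record cstar_subalgebra (R : realType) (A : cstarAlgType R) (B : set A) :
    Prop := {
  cstar_subalgebra_closed : closed B;
  cstar_subalgebra0 : B 0;
  cstar_subalgebraD : forall a b, B a -> B b -> B (a + b);
  cstar_subalgebraZ : forall (k : R[i]) a, B a -> B (k *: a);
  cstar_subalgebraM : forall a b, B a -> B b -> B (a ** b);
  cstar_subalgebraS : forall a, B a -> B (star a)
}.

Definition finite_dimensional (R : realType) (A : cstarAlgType R) (B : set A) :
    Prop :=
  exists (n : nat) (v : 'I_n -> A),
    B = [set \sum_(i < n) c i *: v i | c in [set: 'I_n -> R[i]]].

Definition unital (R : realType) (A : cstarAlgType R) (B : set A) : Prop :=
  exists2 u, B u & forall b, B b -> u ** b = b /\ b ** u = b.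

Definition directed_family (T : Type) (F : set (set T)) : Prop :=
  F !=set0 /\
  forall B C, F B -> F C -> exists D, [/\ F D, B `<=` D & C `<=` D].

Definition approx_by (R : realType) (A : cstarAlgType R) (P : set A -> Prop) :
    Prop :=
  exists F : set (set A),
    [/\ forall B, F B -> cstar_subalgebra B /\ P B,
        directed_family F &
        dense (\bigcup_(B in F) B)].

Definition almost_unital (R : realType) (A : cstarAlgType R) : Prop :=
  approx_by (@unital R A).

Definition approx_finite_dimensional (R : realType) (A : cstarAlgType R) :
    Prop :=
  approx_by (@finite_dimensional R A).

(* Main.v *)
Require Import Defs.
From HB Require Import structures.
From mathcomp Require Import all_boot all_order all_algebra.
From mathcomp Require Import complex ring lra.
From mathcomp Require Import boolp classical_sets functions cardinality.
From mathcomp Require Import reals topology normedtype.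

(* The algebra consists of functions X * Y * nat -> M_2(C), with Y uncountable
   and X so large that no injection X -> Y * nat exists. Let P be the
   projection onto the line of (1, 0) and Q_n the projection onto the line of
   (1, 1/(n+1)), so that Q_n tends to P but Q_n <> P. The algebra is the closed span of p_x (equal to P on the slice of
   x), q_y (equal to Q_n on the slice of y) and, for single pairs (x, y), the
   sequences n |-> w_n in M_2(C) that converge to a multiple of P.

   It is scattered of height three: modulo null sequences at single pairs, and
   then modulo functions living over finitely many pairs, it becomes commutative,
   generated by orthogonal minimal projections.

   If it were almost unital, a unit u_x close to p_x would differ from p_x by an
   element supported over countably many y, so u_x = P over (x, y) for all
   but countably many y, exactly; likewise a unit u_y is Q_n over (x, y) for all
   but countably many x. By the size of X some (x, y) is good for both. A unit
   above u_x and u_y then dominates P and Q_n over (x, y), so it is the identity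
   of M_2(C) at every n, whereas its lower right entry must tend to 0. *)

Set Implicit Arguments.
Unset Strict Implicit.
Unset Printing Implicit Defensive.

Import Order.TTheory GRing.Theory Num.Theory.
Import numFieldNormedType.Exports.
Import ComplexField.Normc.

Local Open Scope classical_set_scope.
Local Open Scope ring_scope.
Local Open Scope complex_scope.

Local Notation Re := complex.Re.
Local Notation Im := complex.Im.

Lemma ord2P (P : 'I_2 -> Prop) : P 0 -> P 1 -> forall i, P i.
Proof.
move=> P0 P1 [[|[|//]] hi].
- by rewrite (_ : Ordinal hi = 0) //; apply/val_inj.
- by rewrite (_ : Ordinal hi = 1) //; apply/val_inj.
Qed.

(** * Real-valued modulus of complex numbers *)

Section Normc.
Variable R : rcfType.
Implicit Types z w : R[i].

Lemma normc_norm z : `|z| = (normc z)%:C.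
Proof. by case: z. Qed.

Lemma normc_ge0 z : 0 <= normc z.
Proof. by rewrite -lecR -normc_norm normr_ge0. Qed.

Lemma normcD z w : normc (z + w) <= normc z + normc w.
Proof. exact: le_normcD. Qed.

Lemma normc_opp z : normc (- z) = normc z.
Proof. exact: normcN. Qed.

Lemma normc_conj z : normc (z^*) = normc z.
Proof. by case: z => a b /=; rewrite sqrrN. Qed.

Lemma sqr_normc_conj z : z^* * z = (normc z ^+ 2)%:C.
Proof. by rewrite mulrC -sqr_normc normc_norm rmorphXn. Qed.

Lemma normc_real (x : R) : normc x%:C = `|x|.
Proof. by rewrite /= expr0n addr0 sqrtr_sqr. Qed.

Lemma normc_Re z : `|Re z| <= normc z.
Proof. by rewrite -lecR -normc_norm; exact: normc_ge_Re. Qed.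

Lemma normc_Im z : `|Im z| <= normc z.
Proof.
case: z => a b /=; rewrite -sqrtr_sqr ler_wsqrtr // lerDr sqr_ge0 //.
Qed.

Lemma normc_le_ReIm z : normc z <= `|Re z| + `|Im z|.
Proof.
rewrite [z in normc z]complexE; apply: le_trans (normcD _ _) _.
rewrite normcM !normc_real /= expr0n add0r expr1n sqrtr1 mul1r lexx //.
Qed.

End Normc.

(** * A Helly-type completeness principle for intervals and discs *)

Section Helly.
Variable R : realType.

(** The supremum of the left endpoints [f d - d] lies below every right endpoint [f e + e]. The
    point found comes with an explicit error at every scale, which is how limits are taken below. *)
Lemma helly_real (f : R -> R) :
  (forall d e, 0 < d -> 0 < e -> `|f d - f e| <= d + e) ->
  exists x, forall e, 0 < e -> `|f e - x| <= e.
Proof.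
move=> h; pose E := [set f d - d | d in [set d | 0 < d]].
have ubE e : 0 < e -> ubound E (f e + e).
  move=> e0 _ [d /= d0 <-]; have := h _ _ d0 e0.
  by rewrite ler_norml => /andP[_]; lra.
have hs : has_sup E.
  by split; [exists (f 1 - 1), 1 => //=; exact: ltr01 | exists (f 1 + 1); apply: ubE].
exists (sup E) => e e0.
have h1 : f e - e <= sup E by apply: sup_upper_bound => //; exists e.
have h2 : sup E <= f e + e by apply: sup_le_ub; [case: hs|apply: ubE].
by rewrite ler_norml; apply/andP; split; lra.
Qed.

(* Intervals that meet pairwise have a common point; apply this to the real and
   to the imaginary parts. The factor 2 comes from replacing discs by squares. *)
Lemma helly_complex (f : R -> R[i]) :
  (forall d e, 0 < d -> 0 < e -> normc (f d - f e) <= d + e) ->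
  exists z, forall e, 0 < e -> normc (f e - z) <= e *+ 2.
Proof.
move=> h.
have [x hx] : exists x, forall e, 0 < e -> `|Re (f e) - x| <= e.
  apply: helly_real => d e d0 e0; apply: le_trans (h _ _ d0 e0).
  by apply: le_trans (normc_Re _); case: (f d) (f e) => ? ? [].
have [y hy] : exists x, forall e, 0 < e -> `|Im (f e) - x| <= e.
  apply: helly_real => d e d0 e0; apply: le_trans (h _ _ d0 e0).
  by apply: le_trans (normc_Im _); case: (f d) (f e) => ? ? [].
exists (x +i* y) => e e0.
have -> : f e - (x +i* y) = (Re (f e) - x) +i* (Im (f e) - y) by case: (f e).
by apply: le_trans (normc_le_ReIm _) _; rewrite mulr2n lerD ?hx ?hy.
Qed.

End Helly.

(** * The operator norm on 2x2 matrices *)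

Section OperatorNorm.
Variable R : realType.
Local Notation C := R[i].
Local Notation M2 := 'M[C]_2.
Implicit Types (u v : 'cV[C]_2) (a b : M2).

Definition ctr m n (a : 'M[C]_(m, n)) : 'M[C]_(n, m) := map_mx conjc a^T.

Lemma ctrK m n (a : 'M[C]_(m, n)) : ctr (ctr a) = a.
Proof. by apply/matrixP => i j; rewrite !mxE conjcK. Qed.

Lemma ctrD m n (a b : 'M[C]_(m, n)) : ctr (a + b) = ctr a + ctr b.
Proof. by rewrite /ctr linearD map_mxD. Qed.

Lemma ctrB m n (a b : 'M[C]_(m, n)) : ctr (a - b) = ctr a - ctr b.
Proof. by apply/matrixP => i j; rewrite !mxE rmorphB. Qed.

Lemma ctrZ m n k (a : 'M[C]_(m, n)) : ctr (k *: a) = k^* *: ctr a.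
Proof. by rewrite /ctr linearZ map_mxZ. Qed.

Lemma ctrM m n p (a : 'M[C]_(m, n)) (b : 'M[C]_(n, p)) :
  ctr (a *m b) = ctr b *m ctr a.
Proof. by rewrite /ctr trmx_mul map_mxM. Qed.

Definition vn v : R := Num.sqrt (normc (v 0 0) ^+ 2 + normc (v 1 0) ^+ 2).

Lemma vn_ge0 v : 0 <= vn v. Proof. exact: sqrtr_ge0. Qed.

Lemma sqr_vn v : vn v ^+ 2 = normc (v 0 0) ^+ 2 + normc (v 1 0) ^+ 2.
Proof. by rewrite sqr_sqrtr // addr_ge0 // sqr_ge0. Qed.

Lemma sum2 (F : 'I_2 -> C) : \sum_i F i = F 0 + F 1.
Proof. by rewrite big_ord_recl big_ord1; congr (F _ + F _); apply/val_inj. Qed.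

Lemma sqr_vnE v : (vn v ^+ 2)%:C = (ctr v *m v) 0 0.
Proof. by rewrite sqr_vn rmorphD /= !mxE sum2 !mxE !sqr_normc_conj. Qed.

Lemma cauchy_schwarz u v : normc ((ctr u *m v) 0 0) <= vn u * vn v.
Proof.
rewrite !mxE sum2 !mxE; apply: le_trans (normcD _ _) _.
rewrite !normcM !normc_conj.
rewrite -(ler_pXn2r (n := 2)) // ?nnegrE ?addr_ge0 ?mulr_ge0 ?vn_ge0 ?normc_ge0 //.
rewrite exprMn !sqr_vn.
set a := normc (u _ _); set b := normc _; set c := normc _; set d := normc _.
(* Lagrange's identity: the two sides differ by exactly this square. *)
by have := sqr_ge0 (a * d - c * b); nra.
Qed.

Lemma vn0 : vn 0 = 0.
Proof. by rewrite /vn !mxE normc0 expr0n addr0 sqrtr0. Qed.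

Lemma vn_eq0 v : vn v = 0 -> v = 0.
Proof.
move=> v0; have := sqr_vn v; rewrite v0 expr0n /= => /esym/eqP.
rewrite paddr_eq0 ?sqr_ge0 // !sqrf_eq0 => /andP[/eqP/eq0_normc h0 /eqP/eq0_normc h1].
by apply/matrixP => i j; rewrite ord1 mxE; move: i; apply: ord2P.
Qed.

Lemma vnZ k v : vn (k *: v) = normc k * vn v.
Proof.
rewrite /vn !mxE !normcM !exprMn -mulrDr sqrtrM ?sqr_ge0 //.
by rewrite sqrtr_sqr ger0_norm ?normc_ge0.
Qed.

Lemma vnD u v : vn (u + v) <= vn u + vn v.
Proof.
rewrite -(ler_pXn2r (n := 2)) // ?nnegrE ?addr_ge0 ?vn_ge0 //.
(* Viewed as a complex number, the square is an entry of a matrix product and expands bilinearly;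
   Cauchy-Schwarz bounds the four terms. *)
apply: (@le_trans _ _ (normc ((vn (u + v) ^+ 2)%:C))).
  by rewrite normc_real ler_norm.
rewrite sqr_vnE ctrD mulmxDl !mulmxDr !mxE.
have h x y : normc ((ctr x *m y) 0 0) <= vn x * vn y by exact: cauchy_schwarz.
apply: le_trans (normcD _ _) _.
have := normcD ((ctr u *m u) 0 0) ((ctr u *m v) 0 0).
have := normcD ((ctr v *m u) 0 0) ((ctr v *m v) 0 0).
have := h u u; have := h u v; have := h v u; have := h v v.
by rewrite !mxE; nra.
Qed.

Definition opn a : R := sup [set vn (a *m v) | v in [set v | vn v <= 1]].

(** A crude bound with two uses: it makes the supremum defining [opn] finite, and it turns entrywise
    estimates into estimates of [opn]. *)
Lemma sum_normc_mul a v :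
  vn (a *m v) <= (normc (a 0 0) + normc (a 0 1) + normc (a 1 0) + normc (a 1 1)) * vn v.
Proof.
set s := _ + _.
have nv i : normc (v i 0) <= vn v.
  rewrite -(ler_pXn2r (n := 2)) // ?nnegrE ?vn_ge0 ?normc_ge0 // sqr_vn.
  by move: i; apply: ord2P; rewrite ?lerDl ?lerDr sqr_ge0.
have rw i : normc ((a *m v) i 0) <= (normc (a i 0) + normc (a i 1)) * vn v.
  rewrite !mxE sum2; apply: le_trans (normcD _ _) _.
  by rewrite !normcM mulrDl lerD // ler_wpM2l ?normc_ge0.
rewrite -(ler_pXn2r (n := 2)) // ?nnegrE ?vn_ge0 ?mulr_ge0 ?vn_ge0 //; last first.
  by rewrite /s !addr_ge0 ?normc_ge0.
rewrite sqr_vn.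
have h0 := rw 0; have h1 := rw 1.
apply: (@le_trans _ _ (((normc (a 0 0) + normc (a 0 1)) * vn v) ^+ 2
  + ((normc (a 1 0) + normc (a 1 1)) * vn v) ^+ 2)).
  by rewrite lerD // ler_pXn2r // ?nnegrE ?normc_ge0 // mulr_ge0 ?addr_ge0 ?normc_ge0 ?vn_ge0.
rewrite !exprMn -mulrDl ler_wpM2r ?sqr_ge0 // /s.
have := normc_ge0 (a 0 0); have := normc_ge0 (a 0 1).
have := normc_ge0 (a 1 0); have := normc_ge0 (a 1 1).
by set p := normc _; set q := normc _; set r := normc _; set t := normc _; nra.
Qed.

Lemma opn_has_sup a : has_sup [set vn (a *m v) | v in [set v | vn v <= 1]].
Proof.
split; first by exists 0, 0; rewrite /= ?vn0 ?ler01 // mulmx0 vn0.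
exists (normc (a 0 0) + normc (a 0 1) + normc (a 1 0) + normc (a 1 1)).
move=> _ [v /= v1 <-]; apply: le_trans (sum_normc_mul _ _) _.
by rewrite ler_piMr // !addr_ge0 ?normc_ge0.
Qed.

Lemma opn_ge0 a : 0 <= opn a.
Proof.
apply: sup_upper_bound; first exact: opn_has_sup.
by exists 0; rewrite /= ?vn0 ?ler01 // mulmx0 vn0.
Qed.

Lemma opn_mul a v : vn (a *m v) <= opn a * vn v.
Proof.
have [v0|v0] := eqVneq (vn v) 0; first by rewrite (vn_eq0 v0) mulmx0 vn0 mulr0.
have vp : 0 < vn v by rewrite lt_def v0 vn_ge0.
rewrite -ler_pdivrMr //.
have -> : vn (a *m v) / vn v = vn (a *m ((vn v)^-1%:C *: v)).
  by rewrite -scalemxAr vnZ normc_real ger0_norm ?invr_ge0 ?vn_ge0 // mulrC.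
apply: sup_upper_bound; first exact: opn_has_sup.
exists ((vn v)^-1%:C *: v) => //=.
by rewrite vnZ normc_real ger0_norm ?invr_ge0 ?vn_ge0 // mulVf.
Qed.

Lemma opn_le a r : 0 <= r -> (forall v, vn (a *m v) <= r * vn v) -> opn a <= r.
Proof.
move=> r0 h; apply: sup_le_ub; first by case: (opn_has_sup a).
by move=> _ [v /= v1 <-]; apply: le_trans (h v) _; rewrite ler_piMr.
Qed.

Lemma opnD a b : opn (a + b) <= opn a + opn b.
Proof.
apply: opn_le => [|v]; first by rewrite addr_ge0 ?opn_ge0.
by rewrite mulmxDl mulrDl; apply: le_trans (vnD _ _) _; rewrite lerD ?opn_mul.
Qed.

Lemma opnM a b : opn (a *m b) <= opn a * opn b.
Proof.
apply: opn_le => [|v]; first by rewrite mulr_ge0 ?opn_ge0.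
rewrite -mulmxA -mulrA; apply: le_trans (opn_mul _ _) _.
by rewrite ler_wpM2l ?opn_ge0 ?opn_mul.
Qed.

Lemma opnZ_le k a : opn (k *: a) <= normc k * opn a.
Proof.
apply: opn_le => [|v]; first by rewrite mulr_ge0 ?opn_ge0 ?normc_ge0.
by rewrite -scalemxAl vnZ -mulrA ler_wpM2l ?opn_mul ?normc_ge0.
Qed.

Lemma opnN a : opn (- a) = opn a.
Proof.
have h b : opn (- b) <= opn b.
  rewrite -scaleN1r; apply: le_trans (opnZ_le _ _) _.
  by rewrite normc_opp normc1 mul1r.
by apply/eqP; rewrite eq_le h -{1}[a]opprK h.
Qed.

Lemma opnB a b : opn (a - b) = opn (b - a).
Proof. by rewrite -opprB opnN. Qed.

Lemma opn0 : opn 0 = 0.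
Proof.
apply/eqP; rewrite eq_le opn_ge0 andbT; apply: opn_le => // v.
by rewrite mul0mx vn0 mul0r.
Qed.

Lemma opn_entry a i j : normc (a i j) <= opn a.
Proof.
have e1 : vn (delta_mx j 0) = 1.
  move: j; apply: ord2P; rewrite /vn !mxE !eqxx /=.
    by rewrite !expr0n !expr1n !addr0 sqrtr0 sqrtr1 expr0n expr1n addr0 sqrtr1.
  by rewrite !expr0n !expr1n !addr0 sqrtr0 sqrtr1 expr0n expr1n add0r sqrtr1.
have := opn_mul a (delta_mx j 0); rewrite e1 mulr1; apply: le_trans.
rewrite -colE -(ler_pXn2r (n := 2)) // ?nnegrE ?vn_ge0 ?normc_ge0 // sqr_vn !mxE.
by move: i; apply: ord2P; rewrite ?lerDl ?lerDr sqr_ge0.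
Qed.

Lemma opn_le_sum a :
  opn a <= normc (a 0 0) + normc (a 0 1) + normc (a 1 0) + normc (a 1 1).
Proof. by apply: opn_le; rewrite ?addr_ge0 ?normc_ge0 //; exact: sum_normc_mul. Qed.

Lemma opn_eq0 a : opn a = 0 -> a = 0.
Proof.
move=> a0; apply/matrixP => i j; rewrite mxE; apply: eq0_normc.
by apply/eqP; rewrite eq_le normc_ge0 andbT -a0 opn_entry.
Qed.

(** The squared length of [a *m v] is the inner product of [v] with [ctr a *m a *m v], so
    Cauchy-Schwarz applies. *)
Lemma opn_sqr_le a : opn a ^+ 2 <= opn (ctr a *m a).
Proof.
rewrite -[leRHS]sqr_sqrtr ?opn_ge0 // ler_pXn2r // ?nnegrE ?sqrtr_ge0 ?opn_ge0 //.
apply: opn_le => [|v]; first exact: sqrtr_ge0.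
rewrite -(ler_pXn2r (n := 2)) // ?nnegrE ?mulr_ge0 ?sqrtr_ge0 ?vn_ge0 //.
rewrite exprMn (sqr_sqrtr (opn_ge0 _)).
apply: (@le_trans _ _ (normc ((vn (a *m v) ^+ 2)%:C))).
  by rewrite normc_real ler_norm.
rewrite sqr_vnE ctrM -mulmxA (mulmxA _ a).
apply: le_trans (cauchy_schwarz _ _) _.
rewrite [leRHS](_ : _ = vn v * (opn (ctr a *m a) * vn v)); last by ring.
by rewrite ler_wpM2l ?vn_ge0 ?opn_mul.
Qed.

(** The previous bound and submultiplicativity give [opn a ^+ 2 <= opn (ctr a) * opn a]; cancel one
    factor. *)
Lemma opn_ctr_le a : opn a <= opn (ctr a).
Proof.
have [->|a0] := eqVneq (opn a) 0; first exact: opn_ge0.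
have ap : 0 < opn a by rewrite lt_def a0 opn_ge0.
rewrite -(ler_pM2r ap) -expr2; apply: le_trans (opn_sqr_le _) (opnM _ _).
Qed.

Lemma opn_ctr a : opn (ctr a) = opn a.
Proof.
by apply/eqP; rewrite eq_le opn_ctr_le andbT; have := opn_ctr_le (ctr a); rewrite ctrK.
Qed.

End OperatorNorm.

(** * C*-algebras of matrix-valued functions *)

Section FunctionAlgebra.
Variables (R : realType) (S : Type).
Local Notation M2 := 'M[R[i]]_2.

(** A uniformly closed star-algebra of bounded functions, kept as a predicate on raw functions.
    Closedness is phrased by approximation, the form in which completeness uses it. *)
Record funalg := Funalg {
  fmem :> (S -> M2) -> Prop;
  fmem0 : fmem (fun=> 0);
  fmemD : forall f g, fmem f -> fmem g -> fmem (fun s => f s + g s);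
  fmemZ : forall k f, fmem f -> fmem (fun s => k *: f s);
  fmemM : forall f g, fmem f -> fmem g -> fmem (fun s => f s *m g s);
  fmem_ctr : forall f, fmem f -> fmem (fun s => ctr (f s));
  fmem_bounded : forall f, fmem f -> exists K : R, forall s, opn (f s) <= K;
  fmem_closed : forall f, (forall e : R, 0 < e ->
    exists2 g, fmem g & forall s, opn (f s - g s) <= e) -> fmem f
}.

Variable D : funalg.

Definition fpred : {pred S -> M2} := fun f => `[< D f >].

Lemma fpredP f : reflect (D f) (f \in fpred).
Proof. exact: asboolP. Qed.

Record felt := Felt { fval :> S -> M2; _ : fval \in fpred }.

HB.instance Definition _ := [isSub for fval].
HB.instance Definition _ := [Choice of felt by <:].

Lemma fpred_submod : submod_closed fpred.
Proof.
split=> [|k f g /fpredP Df /fpredP Dg]; first exact/fpredP/fmem0.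
by apply/fpredP; apply: fmemD => //; apply: fmemZ.
Qed.

HB.instance Definition _ :=
  GRing.isSubmodClosed.Build _ _ fpred fpred_submod.
HB.instance Definition _ := [SubChoice_isSubLmodule of felt by <:].

Lemma feltP (f : felt) : D f. Proof. by apply/fpredP; case: f. Qed.

Definition mkfelt f (Df : D f) : felt := Felt (introT (fpredP f) Df).

Lemma felt_eq (f g : felt) : (forall s, f s = g s) -> f = g.
Proof. by move=> fg; apply/val_inj/funext. Qed.

Implicit Types f g h : felt.

Lemma feltD (f g : felt) s : (f + g) s = f s + g s. Proof. by []. Qed.
Lemma feltN (f : felt) s : (- f) s = - f s. Proof. by []. Qed.
Lemma feltZ k (f : felt) s : (k *: f) s = k *: f s. Proof. by []. Qed.

(* The point 0 keeps the set nonempty when [S] is empty. *)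
Definition supn (f : felt) : R := sup (0 |` range (fun s => opn (f s))).

Lemma supn_has_sup f : has_sup (0 |` range (fun s => opn (f s))).
Proof.
split; first by exists 0; left.
have [K hK] := fmem_bounded (feltP f).
exists (Num.max 0 K) => r [->|[s _ <-]]; first by rewrite le_max lexx.
by rewrite le_max hK orbT.
Qed.

Lemma opn_le_supn (f : felt) s : opn (f s) <= supn f.
Proof.
by apply: sup_upper_bound; [exact: supn_has_sup | right; exists s].
Qed.

Lemma supn_ge0 f : 0 <= supn f.
Proof. by apply: sup_upper_bound; [exact: supn_has_sup | left]. Qed.

Lemma supn_le (f : felt) r : 0 <= r -> (forall s, opn (f s) <= r) -> supn f <= r.
Proof.
move=> r0 h; apply: sup_le_ub; first by case: (supn_has_sup f).
by move=> _ [->|[s _ <-]].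
Qed.

Lemma supnD f g : supn (f + g) <= supn f + supn g.
Proof.
apply: supn_le => [|s]; first by rewrite addr_ge0 ?supn_ge0.
by rewrite feltD; apply: le_trans (opnD _ _) _; rewrite lerD ?opn_le_supn.
Qed.

Lemma supnZ_le k f : supn (k *: f) <= normc k * supn f.
Proof.
apply: supn_le => [|s]; first by rewrite mulr_ge0 ?normc_ge0 ?supn_ge0.
by rewrite feltZ; apply: le_trans (opnZ_le _ _) _; rewrite ler_wpM2l ?normc_ge0 ?opn_le_supn.
Qed.

Lemma supnZ k f : supn (k *: f) = normc k * supn f.
Proof.
apply/eqP; rewrite eq_le supnZ_le /=.
have [->|k0] := eqVneq k 0; first by rewrite normc0 mul0r supn_ge0.
have kp : 0 < normc k.
  by rewrite lt_def normc_ge0 andbT; apply: contra_neq k0 => /eq0_normc.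
rewrite -ler_pdivlMl //.
have := supnZ_le k^-1 (k *: f).
by rewrite scalerA mulVf // scale1r normcV.
Qed.

Lemma supnN f : supn (- f) = supn f.
Proof. by rewrite -scaleN1r supnZ normc_opp normc1 mul1r. Qed.

Lemma supn_eq0 f : supn f = 0 -> f = 0.
Proof.
move=> f0; apply: felt_eq => s; apply: opn_eq0.
by apply/eqP; rewrite eq_le opn_ge0 andbT -f0 opn_le_supn.
Qed.

Definition cnorm f : R[i] := (supn f)%:C.

Lemma cnormD f g : cnorm (f + g) <= cnorm f + cnorm g.
Proof. by rewrite /cnorm -rmorphD lecR supnD. Qed.

Lemma cnormZ k f : cnorm (k *: f) = `|k| * cnorm f.
Proof. by rewrite /cnorm normc_norm -rmorphM supnZ. Qed.

Lemma cnorm_eq0 f : cnorm f = 0 -> f = 0.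
Proof. by move=> /complexI; exact: supn_eq0. Qed.

HB.instance Definition _ := Lmodule_isNormed.Build R[i] felt cnormD cnormZ cnorm_eq0.

Lemma norm_supn (f : felt) : `|f| = (supn f)%:C.
Proof. by []. Qed.

Lemma ball_supn f g (e : R) : ball f e%:C g = (supn (f - g) < e) :> Prop.
Proof. by rewrite -ball_normE /ball_ /= norm_supn ltcR. Qed.

Definition fmul (f g : felt) : felt := mkfelt (fmemM (feltP f) (feltP g)).
Definition fstar (f : felt) : felt := mkfelt (fmem_ctr (feltP f)).

(** Balls belonging to [F] meet pairwise, so their centres satisfy the hypothesis of [helly_complex]
    entry by entry, uniformly in the point [s]. *)
Lemma felt_complete (F : set_system felt) : ProperFilter F -> cauchy F -> cvg F.
Proof.
move=> FF /cauchyP Fc; apply/cvg_ex.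
(* The centre is 0 for nonpositive radii, which makes the choice total. *)
have pick (e : R) : {a | 0 < e -> F (ball a e%:C)}.
  apply: cid; have [e0|e0] := boolP (0 < e); last by exists 0.
  have e0' : 0 < e%:C by rewrite ltcR.
  have [a Fa] := Fc _ e0'.
  by exists a.
pose a e := sval (pick e).
have Fa e : 0 < e -> F (ball (a e) e%:C) by exact: (svalP (pick e)).
have aa d e : 0 < d -> 0 < e -> supn (a d - a e) <= d + e.
  move=> d0 e0.
  have [b []] : ball (a d) d%:C `&` ball (a e) e%:C !=set0.
    by apply: (@filter_ex _ F); apply: filterI; exact: Fa.
  rewrite !ball_supn => db eb.
  rewrite -[a d - a e](_ : (a d - b) - (a e - b) = _); last first.
    by rewrite opprB addrA subrK.
  apply: le_trans (supnD _ _) _; rewrite supnN.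
  exact: lerD (ltW db) (ltW eb).
have lims s i j : {z : R[i] | forall e, 0 < e -> normc (a e s i j - z) <= e *+ 2}.
  apply: cid; apply: helly_complex => d e d0 e0; apply: le_trans (aa d e d0 e0).
  rewrite -[_ - _](_ : ((a d - a e) s) i j = _); last by rewrite feltD feltN !mxE.
  exact: le_trans (opn_entry _ _ _) (opn_le_supn _ _).
pose f s : M2 := \matrix_(i, j) sval (lims s i j).
(* Four entries, each with error at most [2 e]. *)
have fa e s : 0 < e -> opn (a e s - f s) <= e *+ 8.
  move=> e0; apply: le_trans (opn_le_sum _) _; rewrite !mxE.
  have := svalP (lims s 0 0) e e0; have := svalP (lims s 0 1) e e0.
  have := svalP (lims s 1 0) e e0; have := svalP (lims s 1 1) e e0.
  by rewrite /=; lra.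
have Df : D f.
  apply: fmem_closed => e e0; exists (a (e / 8)); first exact: feltP.
  move=> s; rewrite opnB; apply: le_trans (fa _ _ _) _; first by rewrite divr_gt0.
  by lra.
exists (mkfelt Df); apply/cvg_ballP => e e0.
have [r re] : exists r : R, e = r%:C by apply/complex_realP/gtr0_real.
move: e0; rewrite {}re ltcR => r0.
(* The error is 8 parts from [fa] and 1 from the ball, so 10 parts suffice. *)
have d0 : 0 < r / 10 by rewrite divr_gt0.
apply: filterS (Fa _ d0) => b; rewrite !ball_supn => ab.
rewrite -[_ - b](_ : (mkfelt Df - a (r / 10)) + (a (r / 10) - b) = _); last by rewrite addrA subrK.
have h : supn (mkfelt Df - a (r / 10)) <= (r / 10) *+ 8.
  apply: supn_le => [|s]; first by rewrite mulrn_wge0 // ltW.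
  by rewrite feltD feltN opnB fa.
apply: le_lt_trans (supnD _ _) _; apply: lt_le_trans (ler_ltD h ab) _.
by clear -r0; lra.
Qed.

HB.instance Definition _ := Uniform_isComplete.Build felt felt_complete.

Lemma fmulA : associative fmul.
Proof. by move=> f g h; apply: felt_eq => s /=; rewrite mulmxA. Qed.
Lemma fmulDl : left_distributive fmul +%R.
Proof. by move=> f g h; apply: felt_eq => s; exact: mulmxDl. Qed.
Lemma fmulDr : right_distributive fmul +%R.
Proof. by move=> f g h; apply: felt_eq => s; exact: mulmxDr. Qed.
Lemma fscalerAl k f g : k *: fmul f g = fmul (k *: f) g.
Proof. by apply: felt_eq => s; exact: scalemxAl. Qed.
Lemma fscalerAr k f g : k *: fmul f g = fmul f (k *: g).
Proof. by apply: felt_eq => s; exact: scalemxAr. Qed.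
Lemma fstarK : involutive fstar.
Proof. by move=> f; apply: felt_eq => s /=; rewrite ctrK. Qed.
Lemma fstarD : {morph fstar : a b / a + b}.
Proof. by move=> f g; apply: felt_eq => s; exact: ctrD. Qed.
Lemma fstarZ k f : fstar (k *: f) = k^* *: fstar f.
Proof. by apply: felt_eq => s; exact: ctrZ. Qed.
Lemma fstarM f g : fstar (fmul f g) = fmul (fstar g) (fstar f).
Proof. by apply: felt_eq => s /=; rewrite ctrM. Qed.

Lemma supnM f g : supn (fmul f g) <= supn f * supn g.
Proof.
apply: supn_le => [|s]; first by rewrite mulr_ge0 ?supn_ge0.
by apply: le_trans (opnM _ _) _; rewrite ler_pM ?opn_ge0 ?opn_le_supn.
Qed.

Lemma supn_star_le f : supn (fstar f) <= supn f.
Proof.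
apply: supn_le => [|s]; first exact: supn_ge0.
by rewrite (_ : fstar f s = ctr (f s)) // opn_ctr opn_le_supn.
Qed.

Lemma supn_star f : supn (fstar f) = supn f.
Proof.
apply/le_anti/andP; split; first exact: supn_star_le.
by have := supn_star_le (fstar f); rewrite fstarK.
Qed.

(** The nontrivial inequality is [opn_sqr_le] at each point; square roots move the bound inside the
    supremum. *)
Lemma supn_cstar f : supn (fmul (fstar f) f) = supn f ^+ 2.
Proof.
apply/le_anti/andP; split.
  by apply: le_trans (supnM _ _) _; rewrite supn_star expr2.
rewrite -[leRHS](sqr_sqrtr (supn_ge0 _)) ler_pXn2r // ?nnegrE ?sqrtr_ge0 ?supn_ge0 //.
apply: supn_le => [|s]; first exact: sqrtr_ge0.
rewrite -(ler_pXn2r (n := 2)) // ?nnegrE ?sqrtr_ge0 ?opn_ge0 //.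
rewrite (sqr_sqrtr (supn_ge0 _)); apply: le_trans (opn_sqr_le _) _.
exact: (opn_le_supn (fmul (fstar f) f)).
Qed.

Lemma norm_fmul (f g : felt) : `|fmul f g| <= `|f| * `|g|.
Proof. by rewrite !norm_supn -rmorphM lecR supnM. Qed.

Lemma norm_fcstar (f : felt) : `|fmul (fstar f) f| = `|f| ^+ 2.
Proof. by rewrite !norm_supn -rmorphXn supn_cstar. Qed.

HB.instance Definition _ := CompleteNormedModule_isCStarAlgebra.Build R felt
  fmulA fmulDl fmulDr fscalerAl fscalerAr fstarK fstarD fstarZ fstarM
  norm_fmul norm_fcstar.

End FunctionAlgebra.

(** * Quotients and finite-dimensional subalgebras *)

Section RealNorm.
Variables (R : realType) (V : normedModType R[i]).
Implicit Types x y : V.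

Definition rnorm x : R := complex.Re `|x|.

Lemma rnormE x : `|x| = (rnorm x)%:C.
Proof. by rewrite /rnorm RRe_real // normr_real. Qed.

Lemma rnorm_ge0 x : 0 <= rnorm x.
Proof. by rewrite -lecR -rnormE normr_ge0. Qed.

Lemma rnormZ k x : rnorm (k *: x) = normc k * rnorm x.
Proof. by apply: complexI; rewrite rmorphM /= -!rnormE normrZ normc_norm. Qed.

Lemma rnorm_dist x y z : rnorm (x - z) <= rnorm (x - y) + rnorm (y - z).
Proof. by rewrite -lecR rmorphD /= -!rnormE ler_distD. Qed.

Lemma rnorm_sym x y : rnorm (x - y) = rnorm (y - x).
Proof. by apply: complexI; rewrite -!rnormE distrC. Qed.

Lemma rnorm_eq0 x : rnorm x = 0 -> x = 0.
Proof. by move=> x0; apply/eqP; rewrite -normr_eq0 rnormE x0. Qed.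

Lemma rnorm_small x (K : R) : (forall e : R, 0 < e -> rnorm x <= K * e) -> x = 0.
Proof.
move=> h; apply: rnorm_eq0; apply/le_anti; rewrite rnorm_ge0 andbT.
apply/ler_addgt0Pr => e e0; rewrite add0r.
(* The sign of [K] is unknown; [|K| + 1] is positive and dominates it. *)
have K0 : 0 < `|K| + 1 by rewrite ltr_wpDl.
apply: le_trans (h (e / (`|K| + 1)) _) _; first by rewrite divr_gt0.
rewrite mulrA ler_pdivrMr // mulrC ler_wpM2l ?(ltW e0) //.
by rewrite (le_trans (ler_norm K)) // lerDl.
Qed.

End RealNorm.

Section CStarBasics.
Variables (R : realType) (A : cstarAlgType R).
Implicit Types a b p : A.

Lemma cmul0l b : 0 ** b = 0 :> A.
Proof. by apply: (addIr (0 ** b)); rewrite -cmulDl !add0r. Qed.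

Lemma cmul0r b : b ** 0 = 0 :> A.
Proof. by apply: (addIr (b ** 0)); rewrite -cmulDr !add0r. Qed.

Lemma cmulNl a b : (- a) ** b = - (a ** b).
Proof. by apply: (addIr (a ** b)); rewrite -cmulDl !addNr cmul0l. Qed.

Lemma cmulNr a b : a ** (- b) = - (a ** b).
Proof. by apply: (addIr (a ** b)); rewrite -cmulDr !addNr cmul0r. Qed.

Lemma star0 : star 0 = 0 :> A.
Proof. by apply: (addIr (star 0)); rewrite -starD !add0r. Qed.

Lemma cmul_suml n (F : 'I_n -> A) b : (\sum_i F i) ** b = \sum_i F i ** b.
Proof. by apply: (big_morph (fun a => a ** b)) => [x y|]; rewrite ?cmulDl ?cmul0l. Qed.

Lemma cmul_sumr n (F : 'I_n -> A) b : b ** (\sum_i F i) = \sum_i b ** F i.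
Proof. by apply: (big_morph (cmul b)) => [x y|]; rewrite ?cmulDr ?cmul0r. Qed.

Lemma star_sum n (F : 'I_n -> A) : star (\sum_i F i) = \sum_i star (F i).
Proof. by apply: (big_morph star) => [x y|]; rewrite ?starD ?star0. Qed.

Lemma star_mul_eq0 a : star a ** a = 0 -> a = 0.
Proof.
move=> a0; apply/eqP; rewrite -normr_eq0 -sqrf_eq0 -cnorm_star a0 normr0 //.
Qed.

Lemma rnorm_cmul a b : rnorm (a ** b) <= rnorm a * rnorm b.
Proof. by rewrite -lecR rmorphM /= -!rnormE cnormM. Qed.

Lemma projection_rnorm p : projection p -> p != 0 -> rnorm p = 1.
Proof.
move=> [sp pp] p0; have := cnorm_star p; rewrite sp pp => h.
have n0 : `|p| != 0 by rewrite normr_eq0.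
by apply: complexI; rewrite -rnormE; apply: (mulIf n0); rewrite mul1r -expr2 -h.
Qed.

End CStarBasics.

(** * Contractive star-homomorphisms and images of projections *)

Section Quotients.
Variables (R : realType) (A B : cstarAlgType R) (f : A -> B).
Hypothesis fhom : star_hom f.
Hypothesis f_le : forall a, rnorm (f a) <= rnorm a.
Implicit Types a b p g : A.

Lemma star_hom0 : f 0 = 0.
Proof. by have := star_homZ fhom 0 0; rewrite !scale0r. Qed.

Lemma star_homB a b : f (a - b) = f a - f b.
Proof.
by rewrite -[- b]scaleN1r (star_homD fhom) (star_homZ fhom) scaleN1r.
Qed.

(** A contraction has a closed kernel. *)
Lemma star_hom_closure a :
  (forall e : R, 0 < e -> exists2 g, f g = 0 & rnorm (a - g) <= e) -> f a = 0.
Proof.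
move=> h; apply: (@rnorm_small _ _ _ 1) => e /h [g g0 ag]; rewrite mul1r.
by rewrite -[f a]subr0 -g0 -star_homB; apply: le_trans (f_le _) ag.
Qed.

(* Every [f (p ** a ** p)] is a limit of multiples of [f p]; the scalars form a
   Cauchy family since [f p] has norm one. *)
Lemma minimal_projection_image p (G : A -> Prop) :
  (forall b : B, exists a, f a = b) ->
  (forall a (e : R), 0 < e -> exists2 g, G g & rnorm (a - g) <= e) ->
  projection p -> f p != 0 ->
  (forall g, G g -> exists k, f (p ** g ** p) = k *: f p) ->
  minimal_projection (f p).
Proof.
move=> fsurj dG pp fp0 hG.
have fpp : projection (f p).
  by case: pp => sp pp; split; rewrite -?(star_homS fhom) -?(star_homM fhom) ?sp ?pp.
have p0 : p != 0 by apply: contra_neq fp0 => ->; rewrite star_hom0.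
have n1 : rnorm p = 1 by exact: projection_rnorm.
have fn1 : rnorm (f p) = 1 by exact: projection_rnorm.
split=> //; apply/seteqP; split=> [_ [b _ <-]|_ [k _ <-]]; last first.
  exists (k *: f p) => //; case: fpp => _ fpp.
  by rewrite -cscalerAr fpp -cscalerAl fpp.
have [a <-] := fsurj b.
have pick (e : R) : {g | 0 < e -> G g /\ rnorm (a - g) <= e}.
  apply: cid; have [e0|e0] := boolP (0 < e); last by exists 0.
  by have [g Gg ag] := dG a e e0; exists g.
pose g e := sval (pick e).
have coef e : {k | 0 < e -> f (p ** g e ** p) = k *: f p}.
  apply: cid; have [e0|e0] := boolP (0 < e); last by exists 0.
  by have [/hG [k fk] _] := svalP (pick e) e0; exists k.
pose c e := sval (coef e).
have comp x : rnorm (f (p ** x ** p)) <= rnorm x.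
  apply: le_trans (f_le _) _; apply: le_trans (rnorm_cmul _ _) _.
  by rewrite n1 mulr1; apply: le_trans (rnorm_cmul _ _) _; rewrite n1 mul1r.
have compB x y : rnorm (f (p ** x ** p) - f (p ** y ** p)) <= rnorm (x - y).
  apply: le_trans (comp _); rewrite le_eqVlt; apply/orP; left; apply/eqP.
  by rewrite -star_homB cmulDr cmulNr cmulDl cmulNl.
have ga e : 0 < e -> rnorm (a - g e) <= e by case/(svalP (pick e)).
have cE e : 0 < e -> f (p ** g e ** p) = c e *: f p by exact: (svalP (coef e)).
have [z hz] : exists z, forall e, 0 < e -> normc (c e - z) <= e *+ 2.
  apply: helly_complex => d e d0 e0.
  rewrite -[leLHS]mulr1 -fn1 -rnormZ scalerBl -!cE //.
  apply: le_trans (compB _ _) _; apply: le_trans (rnorm_dist _ a _) _.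
  by rewrite rnorm_sym lerD ?ga.
exists z => //; apply/esym/eqP; rewrite -subr_eq0; apply/eqP.
(* One [e] comes from replacing [a] by [g e], two from replacing [c e] by [z]. *)
apply: (@rnorm_small _ _ _ 3) => e e0.
apply: le_trans (rnorm_dist _ (c e *: f p) _) _.
rewrite -scalerBl rnormZ fn1 mulr1 -cE // -!(star_homM fhom).
apply: le_trans (lerD (compB _ _) (hz _ e0)) _.
by have := ga _ e0; lra.
Qed.

End Quotients.

(** * Finite-dimensional subalgebras have a unit *)

Section FiniteDimensional.
Variables (R : realType) (S : Type) (D : funalg R S).
Local Notation A := (felt D).
Implicit Types a b h : A.

Lemma felt_sum n (v : 'I_n -> A) s : (\sum_i v i) s = \sum_i v i s.
Proof. by apply: (big_morph (fun f : A => f s)). Qed.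

(** At each point the diagonal entries of the sum are sums of squared moduli of the entries of the
    [v i]. *)
Lemma sum_star_mul_eq0 n (v : 'I_n -> A) :
  \sum_i star (v i) ** v i = 0 -> forall i, v i = 0.
Proof.
move=> v0 i; apply: felt_eq => s; apply/matrixP => k l; rewrite mxE.
have := felt_sum (fun i => star (v i) ** v i) s; rewrite v0 => /matrixP /(_ l l).
rewrite mxE summxE => /esym/eqP; rewrite psumr_eq0 => [|j _]; last first.
  by rewrite !mxE sumr_ge0 // => m _; rewrite !mxE mulrC mulcJ_ge0.
move=> /allP /(_ i); rewrite mem_index_enum => /(_ isT) /=.
rewrite !mxE psumr_eq0 => [|m _]; last by rewrite !mxE mulrC mulcJ_ge0.
move=> /allP /(_ k); rewrite mem_index_enum => /(_ isT) /=.
rewrite !mxE sqr_normc_conj -(rmorph0 (real_complex R)) (inj_eq (@complexI R)).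
by rewrite sqrf_eq0 => /eqP/eq0_normc.
Qed.

Variable B : set A.
Hypothesis Bsub : cstar_subalgebra B.

(* The powers of [h] are linearly dependent; cancel the lowest power of [h] in a
   relation and solve it for [h]. *)
Lemma left_regular_unit h : B h -> (forall b, B b -> h ** b = 0 -> b = 0) ->
  finite_dimensional B -> exists2 e, B e & h ** e = h.
Proof.
move=> Bh hinj [n [v BE]].
(* [pw k] is the power of [h] with exponent [k + 1]: there is no zeroth power without a unit. *)
pose pw k := iter k (cmul h) h.
have Bpw k : B (pw k) by elim: k => //= k IH; apply: (cstar_subalgebraM Bsub).
have BZ (k : R[i]) b : B b -> B (k *: b) by exact: (cstar_subalgebraZ Bsub).
have Bsum N (c : nat -> R[i]) : B (\sum_(k < N) c k *: pw k).
  elim/big_ind: _ => [|a b|k _]; first exact: (cstar_subalgebra0 Bsub).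
    exact: (cstar_subalgebraD Bsub).
  exact/BZ/Bpw.
have key N (c : nat -> R[i]) : \sum_(k < N) c k *: pw k = 0 ->
    (exists2 k, (k < N)%N & c k != 0) -> exists2 e, B e & h ** e = h.
  elim: N c => [|N IH] c; first by move=> _ [].
  rewrite big_ord_recl /= => s0 [k kN ck].
  have sE : \sum_(i < N) c (bump 0 i) *: pw (bump 0 i) =
      h ** \sum_(i < N) c i.+1 *: pw i.
    by rewrite cmul_sumr; apply: eq_bigr => i _; rewrite -cscalerAr.
  have [c0|c0] := eqVneq (c 0%N) 0.
    apply: (IH (fun k => c k.+1)); last first.
      by case: k kN ck => [|k] kN ck; [rewrite c0 eqxx in ck|exists k].
    apply: hinj; first exact: (Bsum N (fun k => c k.+1)).
    by rewrite -sE; move: s0; rewrite c0 scale0r add0r.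
  exists (- (c 0%N)^-1 *: \sum_(i < N) c i.+1 *: pw i).
    exact/BZ/(Bsum N (fun k => c k.+1)).
  rewrite -cscalerAr -sE; apply: (scalerI c0).
  rewrite scalerA mulrN divff // scaleN1r; apply/eqP.
  by rewrite eq_sym -addr_eq0; apply/eqP.
have coor k : exists c : 'I_n -> R[i], pw k = \sum_i c i *: v i.
  by have := Bpw k; rewrite BE => -[c _ <-]; exists c.
have [C hC] := choice coor.
(* The coordinates of [n + 1] powers in [n] spanning vectors; a nonzero row in the left kernel is a
   linear relation. *)
pose M : 'M[R[i]]_(n.+1, n) := \matrix_(k, j) C k j.
have : kermx M != 0.
  rewrite -mxrank_eq0 mxrank_ker subn_eq0 -ltnNge.
  by rewrite ltnS rank_leq_col.
case/rowV0Pn => c /sub_kermxP cM c0.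
have cE : \sum_(k < n.+1) (c 0 k) *: pw k = 0.
  transitivity (\sum_j (c *m M) 0 j *: v j).
    under eq_bigr do rewrite hC scaler_sumr.
    rewrite exchange_big; apply: eq_bigr => j _; rewrite mxE scaler_suml.
    by apply: eq_bigr => k _; rewrite scalerA mxE.
  by rewrite cM big1 // => j _; rewrite mxE scale0r.
apply: (key n.+1 (fun k => c 0 (inord k))).
  by rewrite -[RHS]cE; apply: eq_bigr => k _; rewrite inord_val.
have [k ck] : exists k, c 0 k != 0.
  apply/existsP; apply: contra_neqT c0 => /existsPn ck.
  by apply/matrixP => i j; rewrite ord1 mxE; apply/eqP; have := ck j; rewrite negbK.
by exists k => //; rewrite inord_val.
Qed.

(* With [h = \sum v_i v_i^*] over a spanning family, [h b = 0] forces
   [v_i^* b = 0] for all [i], hence [b^* b = 0]. *)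
Lemma finite_dimensional_unital : finite_dimensional B -> unital B.
Proof.
move=> Bfd; have [n [v BE]] := Bfd.
have Bv i : B (v i).
  rewrite BE; exists (fun j => (j == i)%:R) => //.
  rewrite (bigD1 i) //= eqxx scale1r big1 ?addr0 // => j /negPf ->.
  by rewrite scale0r.
have Bs a : B a -> B (star a) by exact: (cstar_subalgebraS Bsub).
have BM a b : B a -> B b -> B (a ** b) by exact: (cstar_subalgebraM Bsub).
pose h := \sum_i v i ** star (v i).
have Bh : B h.
  rewrite /h; elim/big_ind: _ => [|a b|i _]; first exact: (cstar_subalgebra0 Bsub).
    exact: (cstar_subalgebraD Bsub).
  by apply: BM => //; apply: Bs.
have hinj b : B b -> h ** b = 0 -> b = 0.
  move=> Bb hb.
  have vb : forall i, star (v i) ** b = 0.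
    apply: sum_star_mul_eq0.
    transitivity (star b ** (h ** b)); last by rewrite hb cmul0r.
    rewrite /h cmul_suml cmul_sumr.
    by apply: eq_bigr => i _; rewrite starM starK !cmulA.
  apply: star_mul_eq0; move: Bb; rewrite {1}BE => -[c _ cb].
  rewrite -{1}cb star_sum cmul_suml big1 // => i _.
  by rewrite starZ -cscalerAl vb scaler0.
have [e Be he] := left_regular_unit Bh hinj Bfd.
have el b : B b -> e ** b = b.
  move=> Bb; apply/eqP; rewrite -subr_eq0; apply/eqP; apply: hinj.
    apply: (cstar_subalgebraD Bsub); first exact: BM.
    by rewrite -scaleN1r; apply: (cstar_subalgebraZ Bsub).
  by rewrite cmulDr cmulNr cmulA he subrr.
have er b : B b -> b ** star e = b.
  by move=> Bb; rewrite -[b]starK -starM el ?starK //; apply: Bs.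
(* A left unit and a right unit agree: both equal [e ** star e]. *)
have se : star e = e by rewrite -[LHS](el _ (Bs _ Be)) (er _ Be).
by exists e => // b Bb; rewrite el // -se er.
Qed.

End FiniteDimensional.

(** * The uniform closure of a star-algebra of bounded functions *)

Section Closure.
Variables (R : realType) (S : Type) (G : (S -> 'M[R[i]]_2) -> Prop).
Local Notation M2 := 'M[R[i]]_2.
Implicit Types f g : S -> M2.
Hypothesis G0 : G (fun=> 0).
Hypothesis GD : forall f g, G f -> G g -> G (fun s => f s + g s).
Hypothesis GZ : forall k f, G f -> G (fun s => k *: f s).
Hypothesis GM : forall f g, G f -> G g -> G (fun s => f s *m g s).
Hypothesis G_ctr : forall f, G f -> G (fun s => ctr (f s)).
Hypothesis G_bounded : forall f, G f -> exists K : R, forall s, opn (f s) <= K.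

Definition uclosure f : Prop :=
  forall e : R, 0 < e -> exists2 g, G g & forall s, opn (f s - g s) <= e.

Lemma uclosure_sub f : G f -> uclosure f.
Proof. by move=> Gf e e0; exists f => // s; rewrite subrr opn0 ltW. Qed.

Lemma uclosureD f g : uclosure f -> uclosure g -> uclosure (fun s => f s + g s).
Proof.
move=> hf hg e e0; have e2 : 0 < e / 2 by rewrite divr_gt0.
have [f' Gf' ff'] := hf _ e2; have [g' Gg' gg'] := hg _ e2.
exists (fun s => f' s + g' s) => [|s]; first exact: GD.
by rewrite opprD addrACA; apply: le_trans (opnD _ _) _; rewrite [e]splitr lerD.
Qed.

Lemma uclosureZ k f : uclosure f -> uclosure (fun s => k *: f s).
Proof.
move=> hf e e0.
have K0 : 0 < normc k + 1 by rewrite ltr_wpDl ?normc_ge0.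
have [f' Gf' ff'] := hf (e / (normc k + 1)) (divr_gt0 e0 K0).
exists (fun s => k *: f' s) => [|s]; first exact: GZ.
rewrite -scalerBr; apply: le_trans (opnZ_le _ _) _.
apply: le_trans (ler_wpM2l (normc_ge0 _) (ff' s)) _.
by rewrite mulrCA ger_pMr // ler_pdivrMr // mul1r lerDl.
Qed.

Lemma uclosure_bounded f : uclosure f -> exists K : R, forall s, opn (f s) <= K.
Proof.
move=> /(_ 1 ltr01) [g /G_bounded [K hK] fg]; exists (1 + K) => s.
by rewrite -[f s](subrK (g s)); apply: le_trans (opnD _ _) _; rewrite lerD.
Qed.

Lemma uclosureM f g : uclosure f -> uclosure g -> uclosure (fun s => f s *m g s).
Proof.
move=> hf hg e e0.
have [Kg hKg] := uclosure_bounded hg.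
have Kg0 : 0 < `|Kg| + 1 by rewrite ltr_wpDl.
have ef0 : 0 < e / 2 / (`|Kg| + 1) by rewrite !divr_gt0.
have [f' Gf' ff'] := hf _ ef0.
(* The splitting below multiplies the error of [g'] by [f'], so [g'] is chosen only after a bound
   for [f'] is known. *)
have [Kf hKf] := G_bounded Gf'.
have Kf0 : 0 < `|Kf| + 1 by rewrite ltr_wpDl.
have eg0 : 0 < e / 2 / (`|Kf| + 1) by rewrite !divr_gt0.
have [g' Gg' gg'] := hg _ eg0.
exists (fun s => f' s *m g' s) => [|s]; first exact: GM.
have -> : f s *m g s - f' s *m g' s = (f s - f' s) *m g s + f' s *m (g s - g' s).
  by rewrite mulmxBl mulmxBr addrA subrK.
apply: le_trans (opnD _ _) _; rewrite [e]splitr lerD //.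
- apply: le_trans (opnM _ _) _; rewrite -[leRHS](divfK (lt0r_neq0 Kg0)).
  rewrite ler_pM ?opn_ge0 // (le_trans (hKg s)) // (le_trans (ler_norm _)) //.
  by rewrite lerDl.
- apply: le_trans (opnM _ _) _; rewrite mulrC -[leRHS](divfK (lt0r_neq0 Kf0)).
  rewrite ler_pM ?opn_ge0 // (le_trans (hKf s)) // (le_trans (ler_norm _)) //.
  by rewrite lerDl.
Qed.

Lemma uclosure_ctr f : uclosure f -> uclosure (fun s => ctr (f s)).
Proof.
move=> hf e e0; have [f' Gf' ff'] := hf _ e0.
exists (fun s => ctr (f' s)) => [|s]; first exact: G_ctr.
by rewrite -ctrB opn_ctr.
Qed.

Lemma uclosure_closed f :
  (forall e : R, 0 < e -> exists2 g, uclosure g & forall s, opn (f s - g s) <= e) ->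
  uclosure f.
Proof.
move=> hf e e0; have e2 : 0 < e / 2 by rewrite divr_gt0.
have [g hg fg] := hf _ e2; have [h Gh gh] := hg _ e2.
exists h => // s; rewrite -[f s](subrK (g s)) -addrA.
by apply: le_trans (opnD _ _) _; rewrite [e]splitr lerD.
Qed.

Definition uclosure_funalg : funalg R S :=
  Funalg (uclosure_sub G0) uclosureD uclosureZ uclosureM uclosure_ctr
    uclosure_bounded uclosure_closed.

End Closure.

(** * The example *)

Section Matrices.
Variable R : realType.
Local Notation C := R[i].
Local Notation M2 := 'M[C]_2.
Implicit Types (v w : nat -> M2).

Definition rate (n : nat) : R := n.+1%:R^-1.

Lemma rate_gt0 n : 0 < rate n. Proof. by rewrite invr_gt0 ltr0n. Qed.

Lemma rate_le1 n : rate n <= 1.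
Proof. by rewrite invf_le1 ?ltr0n // ler1n. Qed.

Lemma rate_small (K e : R) : 0 < e -> exists N, forall n, (N <= n)%N -> K * rate n <= e.
Proof.
move=> e0; have K0 : 0 <= `|K| / e by rewrite divr_ge0 // ltW.
exists (Num.Def.truncn (`|K| / e)) => n Nn.
rewrite ler_pdivrMr ?ltr0n // mulrC -ler_pdivrMr //.
apply: le_trans (_ : `|K| / e <= _); first by rewrite ler_pM2r ?invr_gt0 ?ler_norm.
have /andP[_ /ltW h] := truncn_itv K0.
by apply: le_trans h _; rewrite ler_nat ltnS.
Qed.

Definition projP : M2 := delta_mx 0 0.

(** The rank-one matrix [v *m ctr v] divided by the squared length of [v], for [v] the column (1,
    [rate n]). *)
Definition projQ (n : nat) : M2 :=
  \matrix_(i, j) (rate n ^+ (i + j) / (1 + rate n ^+ 2))%:C.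

Lemma ctr_projP : ctr projP = projP.
Proof. by rewrite /ctr trmx_delta map_delta_mx. Qed.

Lemma projPP : projP *m projP = projP.
Proof. by rewrite mul_delta_mx. Qed.

Lemma tr_projP : \tr projP = 1.
Proof. by rewrite /mxtrace sum2 !mxE /= addr0. Qed.

Lemma projP_compress (a : M2) : projP *m a *m projP = a 0 0 *: projP.
Proof.
apply/matrixP; apply: ord2P; apply: ord2P; rewrite !(mxE, sum2) /=;
  by rewrite !(mul0r, mul1r, mulr0, mulr1, addr0, add0r).
Qed.

Lemma den_gt0 n : 0 < 1 + rate n ^+ 2.
Proof. by rewrite ltr_wpDr ?sqr_ge0. Qed.

Lemma ctr_projQ n : ctr (projQ n) = projQ n.
Proof. by apply/matrixP => i j; rewrite !mxE conjc_real addnC. Qed.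

Lemma projQQ n : projQ n *m projQ n = projQ n.
Proof.
have dn := lt0r_neq0 (den_gt0 n).
apply/matrixP => i j; rewrite !mxE sum2 !mxE -!rmorphM -rmorphD; congr _%:C.
by rewrite /= !addn0 !add0n !exprD /=; field.
Qed.

Lemma tr_projQ n : \tr (projQ n) = 1.
Proof.
have dn := lt0r_neq0 (den_gt0 n).
rewrite /mxtrace sum2 !mxE -rmorphD -(rmorph1 (real_complex R)); congr _%:C.
by rewrite /=; field.
Qed.

Lemma opn_projP : opn projP <= 1.
Proof.
apply: le_trans (opn_le_sum _) _.
have p (i j : 'I_2) : projP i j = ((i == 0) && (j == 0))%:R by rewrite mxE.
by rewrite !p !normc0 [normc _]normc1 !addr0.
Qed.

Lemma idempotent_opn (a : M2) : a *m a = a -> a != 0 -> 1 <= opn a.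
Proof.
move=> aa a0; have ap : 0 < opn a.
  by rewrite lt_def opn_ge0 andbT; apply: contra_neq a0; exact: opn_eq0.
by rewrite -(ler_pM2r ap) mul1r -{1}aa opnM.
Qed.

(** The equation puts [b] in the range of [a], so [a] fixes [b] and the equation becomes
    [k *: b = b]. *)
Lemma idempotent_multiple (a b : M2) (k : C) :
  a *m a = a -> b != 0 -> k *: a *m b = b -> k = 1.
Proof.
move=> aa b0 kb; have ab : a *m b = b by rewrite -{1}kb -scalemxAl -scalemxAr mulmxA aa scalemxAl.
have : (k - 1) *: b = 0 by rewrite scalerBl scale1r -{1}ab scalemxAl kb subrr.
by move/eqP; rewrite scaler_eq0 (negPf b0) orbF subr_eq0 => /eqP.
Qed.

(** Compare lower left entries: the first equation gives [a 1 0 = 0], and then the second gives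
    [a 1 1 * q = q] with [q] nonzero because [rate n] is. *)
Lemma projPQ_upper (a : M2) n :
  a *m projP = projP -> a *m projQ n = projQ n -> a 1 1 = 1.
Proof.
move=> /matrixP/(_ 1 0); rewrite !(mxE, sum2) /= mulr1 mulr0 addr0 => a0.
move=> /matrixP/(_ 1 0); rewrite !(mxE, sum2) a0 mul0r add0r.
set q := (_ / _)%:C => h; apply: (mulIf (x := q)); last by rewrite h mul1r.
rewrite -(rmorph0 (real_complex R)) (inj_eq (@complexI R)).
by rewrite mulf_neq0 ?invr_eq0 ?lt0r_neq0 ?den_gt0 ?exprn_gt0 ?rate_gt0.
Qed.

(* Fixing the rate of convergence keeps the algebra generated below free of
   limits; its uniform closure contains all sequences converging to a multiple
   of [projP]. *)
Definition conv w := exists (c : C) (K : R), forall n, opn (w n - c *: projP) <= K * rate n.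

Lemma conv_rate_ge0 (a : M2) (K : R) n : opn a <= K * rate n -> 0 <= K.
Proof.
move=> h; have := le_trans (opn_ge0 _) h.
by rewrite pmulr_lge0 ?rate_gt0.
Qed.

Lemma conv_bounded w : conv w -> exists K : R, forall n, opn (w n) <= K.
Proof.
move=> [c [K h]]; exists (K + opn (c *: projP)) => n.
rewrite -[w n](subrK (c *: projP)); apply: le_trans (opnD _ _) _.
rewrite lerD2r (le_trans (h n)) // ler_piMr ?rate_le1 //.
exact: conv_rate_ge0 (h 0%N).
Qed.

Lemma conv_null w (K : R) : (forall n, opn (w n) <= K * rate n) -> conv w.
Proof. by move=> h; exists 0, K => n; rewrite scale0r subr0. Qed.

Lemma convD v w : conv v -> conv w -> conv (fun n => v n + w n).
Proof.
move=> [c [K h]] [d [L g]]; exists (c + d), (K + L) => n.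
rewrite scalerDl opprD addrACA mulrDl; apply: le_trans (opnD _ _) _.
by rewrite lerD.
Qed.

Lemma convZ k w : conv w -> conv (fun n => k *: w n).
Proof.
move=> [c [K h]]; exists (k * c), (normc k * K) => n.
rewrite -scalerA -scalerBr -mulrA; apply: le_trans (opnZ_le _ _) _.
by rewrite ler_wpM2l ?normc_ge0.
Qed.

Lemma convM v w : conv v -> conv w -> conv (fun n => v n *m w n).
Proof.
move=> [c [K h]] cw; have [B hB] := conv_bounded cw; case: cw => [d [L g]].
exists (c * d), (K * B + opn (c *: projP) * L) => n.
have -> : v n *m w n - (c * d) *: projP =
    (v n - c *: projP) *m w n + (c *: projP) *m (w n - d *: projP).
  rewrite mulmxBl mulmxBr addrA subrK -scalemxAr -[(c *: projP) *m projP]scalemxAl.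
  by rewrite projPP scalerA [d * c]mulrC.
apply: le_trans (opnD _ _) _; rewrite mulrDl lerD //.
  by apply: le_trans (opnM _ _) _; rewrite mulrAC ler_pM ?opn_ge0.
by apply: le_trans (opnM _ _) _; rewrite -mulrA ler_wpM2l ?opn_ge0.
Qed.

Lemma conv_ctr w : conv w -> conv (fun n => ctr (w n)).
Proof.
move=> [c [K h]]; exists c^*, K => n.
by rewrite -{1}ctr_projP -ctrZ -ctrB opn_ctr.
Qed.

Lemma conv_projP : conv (fun=> projP).
Proof. by exists 1, 0 => n; rewrite scale1r subrr opn0 mul0r. Qed.

Lemma conv_projQ : conv projQ.
Proof.
(* Each of the four entries of [projQ n - projP] has modulus at most [rate n]. *)
exists 1, 4 => n; rewrite scale1r; apply: le_trans (opn_le_sum _) _.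
have dn := den_gt0 n; have dn0 := lt0r_neq0 dn.
have r0 := rate_gt0 n; have r1 := rate_le1 n.
have e00 : projQ n 0 0 - 1 = (- (rate n ^+ 2 / (1 + rate n ^+ 2)))%:C.
  rewrite !mxE -(rmorph1 (real_complex R)) -rmorphB; congr _%:C.
  by rewrite /=; field.
have d2 : rate n ^+ 2 / (1 + rate n ^+ 2) <= rate n.
  by rewrite ler_pdivrMr //; nra.
have d1 : rate n / (1 + rate n ^+ 2) <= rate n.
  by rewrite ler_pdivrMr //; nra.
have p2 : 0 <= rate n ^+ 2 / (1 + rate n ^+ 2) by rewrite divr_ge0 ?sqr_ge0 ?(ltW dn).
have p1 : 0 <= rate n / (1 + rate n ^+ 2) by rewrite divr_ge0 ?(ltW dn) ?(ltW r0).
have q01 : (projQ n - projP) 0 1 = (rate n / (1 + rate n ^+ 2))%:C.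
  by rewrite !mxE /= subr0 expr1.
have q10 : (projQ n - projP) 1 0 = (rate n / (1 + rate n ^+ 2))%:C.
  by rewrite !mxE /= subr0 expr1.
have q11 : (projQ n - projP) 1 1 = (rate n ^+ 2 / (1 + rate n ^+ 2))%:C.
  by rewrite !mxE /= subr0.
have q00 : (projQ n - projP) 0 0 = (- (rate n ^+ 2 / (1 + rate n ^+ 2)))%:C.
  by rewrite -e00 !mxE.
rewrite q00 q01 q10 q11 !normc_real normrN !ger0_norm //.
lra.
Qed.

End Matrices.

(** * The algebra generated by blocks, rows and columns *)

Section Algebra.
Variables (R : realType) (X Y : Type).
Local Notation C := R[i].
Local Notation M2 := 'M[C]_2.
Local Notation S := (X * Y * nat)%type.
Implicit Types (f g : S -> M2) (q : M2) (w : nat -> M2) (x : X) (y : Y).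

Definition blk x y w : S -> M2 := fun s => if `[< s.1 = (x, y) >] then w s.2 else 0.
Definition row_proj x : S -> M2 := fun s => if `[< s.1.1 = x >] then projP R else 0.
Definition col_proj y : S -> M2 := fun s => if `[< s.1.2 = y >] then projQ R s.2 else 0.

(** Only linear operations are constructors. Products and adjoints are recovered from the
    multiplication table of the generators, so later inductions meet no product case. *)
Inductive gen : (S -> M2) -> Prop :=
| gen0 : gen (fun=> 0)
| genD f g : gen f -> gen g -> gen (fun s => f s + g s)
| genZ k f : gen f -> gen (fun s => k *: f s)
| gen_blk x y w : conv w -> gen (blk x y w)
| gen_row x : gen (row_proj x)
| gen_col y : gen (col_proj y).

Lemma gen_ext f g : gen f -> f =1 g -> gen g.
Proof. by move=> Gf fg; rewrite -(funext fg). Qed.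

Lemma conv0 : conv (fun=> 0 : M2).
Proof. by apply: (@conv_null _ _ 0) => n; rewrite opn0 mul0r. Qed.

(** Since [conv] is closed under products, multiplying a block by any generated function yields a
    block again: blocks span an ideal. *)
Lemma gen_conv f : gen f -> forall x y, conv (fun n => f (x, y, n)).
Proof.
move=> Gf x y; elim: Gf => {f} [|f g _ hf _ hg|k f _ hf|x' y' w cw|x'|y'].
- exact: conv0.
- exact: convD.
- exact: convZ.
- by rewrite /blk /=; case: asboolP => _; [exact: cw|exact: conv0].
- by rewrite /row_proj /=; case: asboolP => _; [exact: conv_projP|exact: conv0].
- by rewrite /col_proj /=; case: asboolP => _; [exact: conv_projQ|exact: conv0].
Qed.

Lemma gen_mul_blk f x y w : gen f -> conv w -> gen (fun s => f s *m blk x y w s).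
Proof.
move=> Gf cw; have c := convM (gen_conv Gf x y) cw.
apply: gen_ext (gen_blk x y c) _ => -[[x' y'] n]; rewrite /blk /=.
by case: asboolP => [[-> ->]|_]; rewrite ?mulmx0.
Qed.

Lemma gen_blk_mul f x y w : gen f -> conv w -> gen (fun s => blk x y w s *m f s).
Proof.
move=> Gf cw; have c := convM cw (gen_conv Gf x y).
apply: gen_ext (gen_blk x y c) _ => -[[x' y'] n]; rewrite /blk /=.
by case: asboolP => [[-> ->]|_]; rewrite ?mul0mx.
Qed.

Lemma row_mul_row x x' :
  (fun s => row_proj x s *m row_proj x' s) =
  (fun s => (if `[< x = x' >] then 1 else 0) *: row_proj x s).
Proof.
apply/funext => s; rewrite /row_proj.
case: (asboolP (x = x')) => [->|ne].
  by case: asboolP => _; rewrite scale1r ?projPP ?mulmx0.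
rewrite scale0r; case: (asboolP (_ = x)) => [->|]; last by rewrite mul0mx.
by case: asboolP => // _; rewrite mulmx0.
Qed.

Lemma col_mul_col y y' :
  (fun s => col_proj y s *m col_proj y' s) =
  (fun s => (if `[< y = y' >] then 1 else 0) *: col_proj y s).
Proof.
apply/funext => s; rewrite /col_proj.
case: (asboolP (y = y')) => [->|ne].
  by case: asboolP => _; rewrite scale1r ?projQQ ?mulmx0.
rewrite scale0r; case: (asboolP (_ = y)) => [->|]; last by rewrite mul0mx.
by case: asboolP => // _; rewrite mulmx0.
Qed.

(** A row and a column meet over a single pair, so their product is a block. *)
Lemma row_mul_col x y :
  (fun s => row_proj x s *m col_proj y s) = blk x y (fun n => projP R *m projQ R n).
Proof.
apply/funext => -[[x' y'] n]; rewrite /row_proj /col_proj /blk /=.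
case: (asboolP (x' = x)) => [->|nx].
  case: (asboolP (y' = y)) => [->|ny]; first by case: asboolP.
  by rewrite mulmx0; case: asboolP => // -[].
by rewrite mul0mx; case: asboolP => // -[].
Qed.

Lemma col_mul_row x y :
  (fun s => col_proj y s *m row_proj x s) = blk x y (fun n => projQ R n *m projP R).
Proof.
apply/funext => -[[x' y'] n]; rewrite /row_proj /col_proj /blk /=.
case: (asboolP (x' = x)) => [->|nx].
  case: (asboolP (y' = y)) => [->|ny]; first by case: asboolP.
  by rewrite mul0mx; case: asboolP => // -[].
by rewrite mulmx0; case: asboolP => // -[].
Qed.

Lemma conv_PQ : conv (fun n => projP R *m projQ R n).
Proof. exact: convM (conv_projP R) (conv_projQ R). Qed.

Lemma conv_QP : conv (fun n => projQ R n *m projP R).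
Proof. exact: convM (conv_projQ R) (conv_projP R). Qed.

Lemma genM f g : gen f -> gen g -> gen (fun s => f s *m g s).
Proof.
move=> Gf; elim => {g} [|g h _ hg _ hh|k g _ hg|x y w cw|x|y].
- by apply: gen_ext gen0 _ => s; rewrite mulmx0.
- by apply: gen_ext (genD hg hh) _ => s; rewrite mulmxDr.
- by apply: gen_ext (genZ k hg) _ => s; rewrite scalemxAr.
- exact: gen_mul_blk.
- elim: Gf => {f} [|f h _ hf _ hh|k f _ hf|x' y' w cw|x'|y'].
  + by apply: gen_ext gen0 _ => s; rewrite mul0mx.
  + by apply: gen_ext (genD hf hh) _ => s; rewrite mulmxDl.
  + by apply: gen_ext (genZ k hf) _ => s; rewrite scalemxAl.
  + exact: gen_blk_mul (gen_row x) cw.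
  + by rewrite row_mul_row; apply: genZ; exact: gen_row.
  + by rewrite col_mul_row; apply: gen_blk; exact: conv_QP.
- elim: Gf => {f} [|f h _ hf _ hh|k f _ hf|x' y' w cw|x'|y'].
  + by apply: gen_ext gen0 _ => s; rewrite mul0mx.
  + by apply: gen_ext (genD hf hh) _ => s; rewrite mulmxDl.
  + by apply: gen_ext (genZ k hf) _ => s; rewrite scalemxAl.
  + exact: gen_blk_mul (gen_col y) cw.
  + by rewrite row_mul_col; apply: gen_blk; exact: conv_PQ.
  + by rewrite col_mul_col; apply: genZ; exact: gen_col.
Qed.

Lemma ctr0 : ctr 0 = 0 :> M2.
Proof. by apply/matrixP => i j; rewrite !mxE rmorph0. Qed.

Lemma row_proj_ctr x s : ctr (row_proj x s) = row_proj x s.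
Proof. by rewrite /row_proj; case: asboolP => _; rewrite ?ctr_projP ?ctr0. Qed.

Lemma col_proj_ctr y s : ctr (col_proj y s) = col_proj y s.
Proof. by rewrite /col_proj; case: asboolP => _; rewrite ?ctr_projQ ?ctr0. Qed.

Lemma gen_ctr f : gen f -> gen (fun s => ctr (f s)).
Proof.
elim=> {f} [|f g _ hf _ hg|k f _ hf|x y w cw|x|y].
- by apply: gen_ext gen0 _ => s; rewrite ctr0.
- by apply: gen_ext (genD hf hg) _ => s; rewrite ctrD.
- by apply: gen_ext (genZ (k^*) hf) _ => s; rewrite ctrZ.
- apply: gen_ext (gen_blk x y (conv_ctr cw)) _ => s.
  by rewrite /blk; case: asboolP => _; rewrite ?ctr0.
- by apply: gen_ext (gen_row x) _ => s; rewrite row_proj_ctr.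
- by apply: gen_ext (gen_col y) _ => s; rewrite col_proj_ctr.
Qed.

Lemma gen_bounded f : gen f -> exists K : R, forall s, opn (f s) <= K.
Proof.
elim=> {f} [|f g _ [K hK] _ [L hL]|k f _ [K hK]|x y w cw|x|y].
- by exists 0 => s; rewrite opn0.
- by exists (K + L) => s; apply: le_trans (opnD _ _) _; rewrite lerD.
- exists (normc k * K) => s; apply: le_trans (opnZ_le _ _) _.
  by rewrite ler_wpM2l ?normc_ge0.
- have [K hK] := conv_bounded cw; exists K => s; rewrite /blk.
  by case: asboolP => _ //; rewrite opn0 (le_trans (opn_ge0 _) (hK 0%N)).
- exists 1 => s; rewrite /row_proj.
  by case: asboolP => _; [exact: opn_projP|rewrite opn0 ler01].
- have [K hK] := conv_bounded (conv_projQ R); exists K => s; rewrite /col_proj.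
  by case: asboolP => _ //; rewrite opn0 (le_trans (opn_ge0 _) (hK 0%N)).
Qed.

Definition alg_funalg : funalg R S :=
  uclosure_funalg gen0 genD genZ genM gen_ctr gen_bounded.

Local Notation A := (felt alg_funalg).
Implicit Types a b : A.

Definition of_gen f (Gf : gen f) : A := mkfelt (D := alg_funalg) (uclosure_sub Gf).

Definition eblk x y w (cw : conv w) : A := of_gen (gen_blk x y cw).
Definition erow x : A := of_gen (gen_row x).
Definition ecol y : A := of_gen (gen_col y).

Lemma of_gen_ind (Pr : A -> Prop) :
  Pr 0 -> (forall a b, Pr a -> Pr b -> Pr (a + b)) -> (forall k a, Pr a -> Pr (k *: a)) ->
  (forall x y w (cw : conv w), Pr (eblk x y cw)) -> (forall x, Pr (erow x)) ->
  (forall y, Pr (ecol y)) -> forall a, gen a -> Pr a.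
Proof.
move=> P0 PD PZ Pb Pr' Pc a Ga.
(* [gen] speaks of raw functions and [Pr] of elements of the algebra, so the induction covers every
   element with the given values. *)
suff h f (Gf : gen f) : forall b, b =1 f -> Pr b by exact: h Ga a (fun=> erefl).
elim: Gf => {f} [|f g Gf hf Gg hg|k f Gf hf|x y w cw|x|y] b bf.
- by rewrite (_ : b = 0) //; apply: felt_eq.
- rewrite (_ : b = of_gen Gf + of_gen Gg); last exact: felt_eq.
  by apply: PD; [apply: hf|apply: hg].
- rewrite (_ : b = k *: of_gen Gf); last exact: felt_eq.
  by apply: PZ; apply: hf.
- by rewrite (_ : b = eblk x y cw) //; apply: felt_eq.
- by rewrite (_ : b = erow x) //; apply: felt_eq.
- by rewrite (_ : b = ecol y) //; apply: felt_eq.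
Qed.

Lemma felt_rnorm a : rnorm a = supn a.
Proof. by []. Qed.

Lemma gen_dense a (e : R) : 0 < e -> exists2 g : A, gen g & rnorm (a - g) <= e.
Proof.
move=> e0; have [g Gg ag] := feltP a e e0; exists (of_gen Gg) => //.
by rewrite felt_rnorm; apply: supn_le => [|s]; [exact: ltW|exact: ag].
Qed.

Lemma erow_proj x : projection (erow x).
Proof.
split; apply: felt_eq => s; first exact: row_proj_ctr.
by have /(congr1 (@^~ s)) := row_mul_row x x; rewrite asboolT // scale1r.
Qed.

Lemma ecol_proj y : projection (ecol y).
Proof.
split; apply: felt_eq => s; first exact: col_proj_ctr.
by have /(congr1 (@^~ s)) := col_mul_col y y; rewrite asboolT // scale1r.
Qed.

(** * Minimal projections in every nonzero quotient *)

Section Scattered.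
Variables (B : cstarAlgType R) (f : A -> B).
Hypothesis fhom : star_hom f.
Hypothesis f_le : forall a, rnorm (f a) <= rnorm a.

Definition spike (m : nat) q : nat -> M2 := fun n => if n == m then q else 0.

Lemma conv_spike m q : conv (spike m q).
Proof.
apply: (@conv_null _ _ (opn q * m.+1%:R)) => n; rewrite /spike.
case: eqVneq => [->|_]; first by rewrite -mulrA divff ?mulr1 // pnatr_eq0.
by rewrite opn0 !mulr_ge0 ?opn_ge0 // ltW ?rate_gt0.
Qed.

Definition espike x y m q : A := eblk x y (conv_spike m q).

Lemma eblk_mul x y v w (cv : conv v) (cw : conv w) :
  eblk x y cv ** eblk x y cw = eblk x y (convM cv cw).
Proof.
by apply: felt_eq => s /=; rewrite /blk; case: asboolP => _; rewrite ?mulmx0.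
Qed.

Lemma eblk_ext x y v w (cv : conv v) (cw : conv w) :
  v =1 w -> eblk x y cv = eblk x y cw.
Proof. by move=> vw; apply: felt_eq => s /=; rewrite /blk vw. Qed.

(** The full matrix algebra is generated as an ideal by [projP]: matrix units give [q = q *m projP +
    q *m e10 *m projP *m e01]. *)
Lemma spike_kill x y m q : f (espike x y m (projP R)) = 0 -> f (espike x y m q) = 0.
Proof.
move=> h.
pose e10 : M2 := delta_mx 1 0; pose e01 : M2 := delta_mx 0 1.
have -> : espike x y m q = espike x y m q ** espike x y m (projP R) +
    espike x y m (q *m e10) ** espike x y m (projP R) ** espike x y m e01.
  rewrite /espike !eblk_mul; apply: felt_eq => s; rewrite feltD /= /blk.
  case: asboolP => _; last by rewrite addr0.
  rewrite /spike; case: eqP => _; last by rewrite !mul0mx addr0.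
  rewrite -!mulmxA -mulmxDr mul_delta_mx mul_delta_mx -[LHS]mulmx1; congr (_ *m _).
  apply/matrixP; apply: ord2P; apply: ord2P; rewrite !mxE /=; by rewrite ?addr0 ?add0r.
by rewrite (star_homD fhom) !(star_homM fhom) h !cmul0r cmul0l add0r.
Qed.

(** Truncations of [w] are finite sums of spikes and converge uniformly to [w], so closedness of the
    kernel applies. *)
Lemma null_kill x y w (cw : conv w) (K : R) :
  (forall m q, f (espike x y m q) = 0) -> (forall n, opn (w n) <= K * rate R n) ->
  f (eblk x y cw) = 0.
Proof.
move=> h wK; apply: (star_hom_closure fhom f_le) => e e0.
have ct N : conv (fun n => if (n < N)%N then w n else 0).
  apply: (@conv_null _ _ K) => n; case: ifP => // _.
  by rewrite opn0 (le_trans (opn_ge0 _) (wK n)).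
have [N hN] := rate_small K e0.
exists (eblk x y (ct N)).
  elim: N {hN} => [|N IH].
    rewrite (_ : eblk _ _ _ = 0) ?star_hom0 //.
    by apply: felt_eq => s /=; rewrite /blk; case: asboolP.
  rewrite (_ : eblk x y (ct N.+1) = eblk x y (ct N) + espike x y N (w N)).
    by rewrite (star_homD fhom) IH h addr0.
  apply: felt_eq => s; rewrite feltD /= /blk; case: asboolP => _; last by rewrite addr0.
  rewrite /spike ltnS leq_eqVlt; case: (eqVneq s.2 N) => [->|_] /=.
    by rewrite ltnn add0r.
  by rewrite addr0.
rewrite felt_rnorm; apply: supn_le => [|s]; first exact: ltW.
rewrite feltD feltN /= /blk; case: asboolP => _; last by rewrite subr0 opn0 ltW.
case: ltnP => sN; first by rewrite subrr opn0 ltW.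
by rewrite subr0; apply: le_trans (wK _) (hN _ sN).
Qed.

Local Notation cornerE x y := (eblk x y (conv_projP R)).

Lemma eblk_split x y w (cw : conv w) :
  exists c K (cd : conv (fun n => w n - c *: projP R)),
    eblk x y cw = c *: cornerE x y + eblk x y cd /\
    forall n, opn (w n - c *: projP R) <= K * rate R n.
Proof.
have [c [K h]] := cw; exists c, K, (conv_null h); split=> //.
apply: felt_eq => s; rewrite feltD feltZ /= /blk.
by case: asboolP => _; rewrite ?scaler0 ?addr0 // addrC subrK.
Qed.

Hypothesis fsurj : forall b : B, exists a, f a = b.

(** Spikes, constant blocks, rows and columns are tried in this order. The first kind with a member
    that survives under [f] gives a minimal projection, because the obstructions to minimality were
    killed earlier. *)
Lemma minimal_exists : (exists b : B, b != 0) -> exists p : B, minimal_projection p.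
Proof.
move=> [b0 b0N].
have min p : projection p -> f p != 0 ->
    (forall g : A, gen g -> exists k, f (p ** g ** p) = k *: f p) ->
    minimal_projection (f p).
  by move=> pp fp; exact: (minimal_projection_image fhom f_le fsurj gen_dense pp fp).
have [[[x y] [m nz]]|spk0] := pselect (exists xy m, f (espike xy.1 xy.2 m (projP R)) != 0).
  exists (f (espike x y m (projP R))); apply: min nz _.
    split.
      apply: felt_eq => s /=; rewrite /blk; case: asboolP => _; last exact: ctr0.
      by rewrite /spike; case: eqP => _; [exact: ctr_projP|exact: ctr0].
    rewrite eblk_mul; apply: eblk_ext => n.
    by rewrite /spike; case: eqP => _; rewrite ?mul0mx ?projPP.
  move=> g _; exists (g (x, y, m) 0 0); rewrite -(star_homZ fhom); congr f.
  apply: felt_eq => -[[x' y'] n]; rewrite feltZ /= /blk /spike /=.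
  case: asboolP => [[-> ->]|_]; last by rewrite mulmx0 scaler0.
  by case: eqP => [->|_]; rewrite ?projP_compress // mulmx0 scaler0.
have spk x y m q : f (espike x y m q) = 0.
  by apply: spike_kill; apply: contrapT => /eqP h; apply: spk0; exists (x, y), m.
(* Once spikes die, [f] sees of a block only the coefficient of its limit, so compressions to a
   constant block become scalar. *)
have [[[x y] /= nz]|E0] := pselect (exists xy, f (cornerE xy.1 xy.2) != 0).
  exists (f (cornerE x y)); apply: min nz _.
    split.
      by apply: felt_eq => s /=; rewrite /blk; case: asboolP => _; [exact: ctr_projP|exact: ctr0].
    by rewrite eblk_mul; apply: eblk_ext => n; rewrite projPP.
  move=> g Gg; have cg := gen_conv Gg x y.
  have cw := convM (convM (conv_projP R) cg) (conv_projP R).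
  have -> : cornerE x y ** g ** cornerE x y = eblk x y cw.
    apply: felt_eq => -[[x' y'] n] /=; rewrite /blk /=.
    by case: asboolP => [[-> ->]|_] //; rewrite mulmx0.
  have [c [K [cd [-> hK]]]] := eblk_split x y cw; exists c.
  by rewrite (star_homD fhom) (star_homZ fhom) (null_kill _ (spk x y) hK) addr0.
have blk0 x y w (cw : conv w) : f (eblk x y cw) = 0.
  have [c [K [cd [-> hK]]]] := eblk_split x y cw.
  rewrite (star_homD fhom) (star_homZ fhom) (null_kill _ (spk x y) hK) addr0.
  rewrite (_ : f (cornerE x y) = 0) ?scaler0 //.
  by apply: contrapT => /eqP h; apply: E0; exists (x, y).
have rcr x y : f (erow x ** ecol y) = 0.
  rewrite (_ : _ ** _ = eblk x y conv_PQ) ?blk0 //.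
  by apply: felt_eq => s; have /(congr1 (@^~ s)) := row_mul_col x y.
(* Compression is linear and blocks now vanish, so only rows and columns remain to be checked. *)
have comp_ind p : (forall x, exists k, f (p ** erow x ** p) = k *: f p) ->
    (forall y, exists k, f (p ** ecol y ** p) = k *: f p) ->
    forall g : A, gen g -> exists k, f (p ** g ** p) = k *: f p.
  move=> hr hc; apply: of_gen_ind => //.
  - by exists 0; rewrite cmul0r cmul0l star_hom0 // scale0r.
  - move=> a b [k ha] [l hb]; exists (k + l).
    by rewrite cmulDr cmulDl (star_homD fhom) ha hb scalerDl.
  - move=> k a [l ha]; exists (k * l).
    by rewrite -cscalerAr -cscalerAl (star_homZ fhom) ha scalerA.
  - move=> x y w cw; exists 0.
    by rewrite !(star_homM fhom) blk0 cmul0r cmul0l scale0r.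
(* Distinct rows are orthogonal, and a row times a column is a block, hence killed. *)
have [[x nz]|row0] := pselect (exists x, f (erow x) != 0).
  exists (f (erow x)); apply: min nz _; first exact: erow_proj.
  apply: comp_ind => [x'|y].
    exists (if `[< x = x' >] then 1 else 0).
    rewrite (_ : erow x ** erow x' = (if `[< x = x' >] then 1 else 0) *: erow x); last first.
      by apply: felt_eq => s; have /(congr1 (@^~ s)) := row_mul_row x x'.
    by rewrite -cscalerAl (erow_proj x).2 (star_homZ fhom).
  by exists 0; rewrite (star_homM fhom) rcr cmul0l scale0r.
have {}row0 x : f (erow x) = 0.
  by apply: contrapT => /eqP h; apply: row0; exists x.
have [[y nz]|col0] := pselect (exists y, f (ecol y) != 0).
  exists (f (ecol y)); apply: min nz _; first exact: ecol_proj.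
  apply: comp_ind => [x|y'].
    by exists 0; rewrite !(star_homM fhom) row0 cmul0r cmul0l scale0r.
  exists (if `[< y = y' >] then 1 else 0).
  rewrite (_ : ecol y ** ecol y' = (if `[< y = y' >] then 1 else 0) *: ecol y); last first.
    by apply: felt_eq => s; have /(congr1 (@^~ s)) := col_mul_col y y'.
  by rewrite -cscalerAl (ecol_proj y).2 (star_homZ fhom).
have {}col0 y : f (ecol y) = 0.
  by apply: contrapT => /eqP h; apply: col0; exists y.
(* No generator survives, so [f] vanishes on a dense set and hence everywhere, contradicting
   [b0 != 0]. *)
have gen_kill (g : A) : gen g -> f g = 0.
  move: g; apply: of_gen_ind => //.
  - exact: star_hom0.
  - by move=> a b ha hb; rewrite (star_homD fhom) ha hb addr0.
  - by move=> k a ha; rewrite (star_homZ fhom) ha scaler0.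
case/negP: b0N; have [a <-] := fsurj b0; apply/eqP.
apply: (star_hom_closure fhom f_le) => e e0.
by have [g Gg ag] := gen_dense a e0; exists g; rewrite ?gen_kill.
Qed.

End Scattered.

Lemma alg_scattered : scattered A.
Proof.
move=> B [I [f [cI qf]]]; apply: minimal_exists.
- exact: quotient_map_hom qf.
- move=> a; rewrite -lecR -!rnormE.
  have := quotient_map_norm_le qf a (closed_ideal0 cI).
  by rewrite addr0.
- exact: quotient_map_surj qf.
Qed.

End Algebra.

Arguments row_proj {R X Y} x _.
Arguments col_proj {R X Y} y _.
Arguments erow {R X Y} x.
Arguments ecol {R X Y} y.

(** * Failure of almost unitality *)

Section Countability.

Lemma countable_setU T (A B : set T) : countable A -> countable B -> countable (A `|` B).
Proof.
move=> cA cB; pose F (b : bool) := if b then A else B.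
apply: (@sub_countable _ _ _ (\bigcup_(b in [set: bool]) F b)).
  by apply: subset_card_le => t [At|Bt]; [exists true|exists false].
apply: bigcup_countable => [|b _]; last by case: b.
exact: finite_set_countable.
Qed.

Lemma cantor_injective T (f : set T -> T) : ~ injective f.
Proof.
move=> finj; pose D := [set t | exists2 A, f A = t & ~ A t].
have nD : ~ D (f D) by move=> DD; case: (DD) => A /finj -> /(_ DD).
by apply: (nD); exists D.
Qed.

Lemma uncountable_set_nat : ~ countable [set: set nat].
Proof.
move=> /countable_injP [f finj]; apply: (@cantor_injective _ f) => A B fAB.
by apply: finj; rewrite ?in_setT.
Qed.

(* Choosing for each [x] some [y] with [x] in the countable set [CY y] would
   inject [set (set nat * nat)] into [set nat * nat]. *)
Lemma free_pair (CX : set (set nat * nat) -> set (set nat))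
    (CY : set nat -> set (set (set nat * nat))) :
  (forall x, countable (CX x)) -> (forall y, countable (CY y)) ->
  exists x y, ~ CX x y /\ ~ CY y x.
Proof.
move=> cX cY.
have [x xN] : exists x, forall y, ~ CY y x.
  apply: contrapT => h.
  have hc x : exists y, CY y x.
    by apply: contrapT => hx; apply: h; exists x => y cy; apply: hx; exists y.
  have [g hg] := choice hc.
  have [e he] := choice (fun y => countable_injP _ (cY y)).
  (* The first component fixes the countable set containing [x], the second is the code of [x] in
     it. *)
  apply: (@cantor_injective _ (fun x => (g x, e (g x) x))) => x x' [gx].
  rewrite -gx; apply: he; apply/mem_set; [exact: hg|rewrite gx; exact: hg].
(* This [x] avoids every [CY y]; were no [y] outside [CX x], that countable set would contain all
   sets of naturals. *)
exists x; apply: contrapT => h; apply: uncountable_set_nat.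
apply: sub_countable (cX x); apply: subset_card_le => y _.
by apply: contrapT => hy; apply: h; exists y.
Qed.

End Countability.

(** * Exceptional fibres are countable, and no approximating family of unital subalgebras exists *)

Section Lines.
Variables (R : realType) (X Y : Type).
Local Notation M2 := 'M[R[i]]_2.
Local Notation S := (X * Y * nat)%type.
Local Notation A := (felt (alg_funalg R X Y)).
Implicit Types (f : S -> M2) (W : nat -> M2) (a : A) (x : X) (y : Y).

(** When [W n] has trace one, a multiple of [W n] has its trace as coefficient. Written this way the
    condition of being on the line is linear and survives limits. *)
Definition off_line f W (z : X * Y) : Prop :=
  exists n, f (z, n) <> \tr (f (z, n)) *: W n.

Lemma on_line f W z : ~ off_line f W z -> forall n, f (z, n) = \tr (f (z, n)) *: W n.
Proof. by move=> h n; apply: contrapT => hn; apply: h; exists n. Qed.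

Lemma normc_tr (m : M2) : normc (\tr m) <= opn m *+ 2.
Proof.
by rewrite /mxtrace sum2; apply: le_trans (normcD _ _) _; rewrite mulr2n lerD ?opn_entry.
Qed.

Section Family.
Variables (T : Type) (z : T -> X * Y) (W : nat -> M2).
Hypothesis z_inj : injective z.
Hypothesis row_line : forall x, countable [set t | off_line (row_proj x) W (z t)].
Hypothesis col_line : forall y, countable [set t | off_line (col_proj y) W (z t)].

(** [z] parametrizes a row or a column of pairs, so both cases are handled at once. A sum is
    exceptional only where a summand is, and a block at one index at most by injectivity of [z]. *)
Lemma gen_line_countable f : gen f -> countable [set t | off_line f W (z t)].
Proof.
elim=> {f} [|f g _ hf _ hg|k f _ hf|x y w _|x|y].
- apply: sub_countable (@countable0 T); apply: subset_card_le => t [n] /=.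
  by rewrite mxtrace0 scale0r.
- apply: sub_countable (countable_setU hf hg); apply: subset_card_le => t ht.
  apply: contrapT => /not_orP [/on_line lf /on_line lg]; case: ht => n; apply.
  by rewrite mxtraceD scalerDl -lf -lg.
- apply: sub_countable hf; apply: subset_card_le => t ht.
  apply: contrapT => /on_line lf; case: ht => n; apply.
  by rewrite mxtraceZ -scalerA -lf.
- apply: (@sub_countable _ _ _ (z @^-1` [set (x, y)])).
    apply: subset_card_le => t [n] /=; rewrite /blk /=.
    by case: asboolP => // _; rewrite mxtrace0 scale0r.
  have [[t0 t0z]|h] := pselect (exists t, z t = (x, y)); last first.
    apply: sub_countable (@countable0 T); apply: subset_card_le => t tz.
    by apply: h; exists t.
  apply: sub_countable (@countable1 T t0); apply: subset_card_le => t tz.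
  by apply: z_inj; rewrite t0z.
- exact: row_line.
- exact: col_line.
Qed.

(** A fibre on which every approximant [g k] is on the line is on the line for [a] too, so the
    exceptional set lies in a countable union. *)
Lemma line_countable (K : R) a : (forall n, opn (W n) <= K) ->
  countable [set t | off_line a W (z t)].
Proof.
move=> WK.
have ex k : exists g : A, gen g /\ rnorm (a - g) <= rate R k.
  by have [g] := gen_dense a (rate_gt0 R k); exists g.
have [g hg] := choice ex.
apply: (@sub_countable _ _ _ (\bigcup_(k in [set: nat]) [set t | off_line (g k) W (z t)])).
  apply: subset_card_le => t ht; apply: contrapT => h.
  have lg k : forall n, g k (z t, n) = \tr (g k (z t, n)) *: W n.
    by apply: on_line => hk; apply: h; exists k.
  case: ht => n; apply; apply/eqP; rewrite -subr_eq0; apply/eqP; apply: opn_eq0.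
  apply/le_anti; rewrite opn_ge0 andbT; apply/ler_addgt0Pr => e e0; rewrite add0r.
  (* An error [d] in [a] costs [d] directly and [2 d K] through the trace term, the trace being at
     most twice the norm. *)
  have [N /(_ N (leqnn N)) hN] := rate_small (1 + 2 * K) e0.
  apply: le_trans hN.
  have [_ ag] := hg N.
  have ags : opn (a (z t, n) - g N (z t, n)) <= rate R N.
    by apply: le_trans ag; exact: (opn_le_supn (a - g N)).
  have -> : a (z t, n) - \tr (a (z t, n)) *: W n =
     (a (z t, n) - g N (z t, n)) - \tr (a (z t, n) - g N (z t, n)) *: W n.
    by rewrite raddfB /= scalerBl opprB -lg addrA subrK.
  apply: le_trans (opnD _ _) _; rewrite opnN mulrDl mul1r lerD //.
  apply: le_trans (opnZ_le _ _) _; rewrite mulrAC.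
  apply: ler_pM; rewrite ?normc_ge0 ?opn_ge0 //.
  by apply: le_trans (normc_tr _) _; rewrite -[leLHS]mulr_natl ler_wpM2l.
apply: bigcup_countable => [|k _]; first exact: countableP.
by apply: gen_line_countable; have [] := hg k.
Qed.

End Family.

Lemma row_line_countable a x : countable [set y | off_line a (fun=> projP R) (x, y)].
Proof.
apply: (@line_countable Y (pair x) _ _ _ _ 1) => [y y' []|x'|y'|n] //; last exact: opn_projP.
- apply: sub_countable (@countable0 Y); apply: subset_card_le => y [n] /=.
  rewrite /row_proj /=; case: asboolP => _; first by rewrite tr_projP scale1r.
  by rewrite mxtrace0 scale0r.
- apply: sub_countable (@countable1 Y y'); apply: subset_card_le => y [n] /=.
  rewrite /col_proj /=; case: asboolP => // _.
  by rewrite mxtrace0 scale0r.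
Qed.

Lemma col_line_countable a y : countable [set x | off_line a (projQ R) (x, y)].
Proof.
have [K hK] := conv_bounded (conv_projQ R).
apply: (@line_countable X (fun x => (x, y)) _ _ _ _ K) => [x x' []|x'|y'|n] //.
- apply: sub_countable (@countable1 X x'); apply: subset_card_le => x [n] /=.
  rewrite /row_proj /=; case: asboolP => // _.
  by rewrite mxtrace0 scale0r.
- apply: sub_countable (@countable0 X); apply: subset_card_le => x [n] /=.
  rewrite /col_proj /=; case: asboolP => _; first by rewrite tr_projQ scale1r.
  by rewrite mxtrace0 scale0r.
Qed.

(** A nonzero idempotent has norm at least 1, so [b] is nonzero. As [u] fixes [b], its coefficient
    along [m] must be 1. *)
Lemma unit_on_line (u b m : M2) : m *m m = m -> m != 0 ->
  u = \tr u *: m -> u *m b = b -> opn (m - b) < 1 -> u = m.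
Proof.
move=> mm m0 um ub mb.
have b0 : b != 0.
  by apply: contraTneq mb => ->; rewrite subr0 -leNgt; apply: idempotent_opn.
rewrite um (_ : \tr u = 1) ?scale1r //.
by apply: (idempotent_multiple mm b0); rewrite -um.
Qed.

(** Multiples of [projP] have zero lower right entry. A generated approximant within a quarter of
    [a] therefore has that entry below a quarter at some [n], and the two errors sum to less than
    1. *)
Lemma corner_vanishes a x y : exists n, a (x, y, n) 1 1 != 1.
Proof.
have e4 : (0 : R) < 4^-1 by rewrite invr_gt0.
have [g Gg ag] := gen_dense a e4.
have [c [K hK]] := gen_conv Gg x y.
have [n /(_ n (leqnn n)) hn] := rate_small K e4; exists n.
have h1 : normc ((g (x, y, n)) 1 1) <= 4^-1.
  apply: le_trans hn; apply: le_trans (hK n).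
  have := opn_entry (g (x, y, n) - c *: projP R) 1 1.
  by rewrite !mxE mulr0 subr0.
have h2 : normc (a (x, y, n) 1 1 - g (x, y, n) 1 1) <= 4^-1.
  apply: le_trans ag; apply: le_trans (opn_le_supn (a - g) (x, y, n)).
  by have := opn_entry ((a - g) (x, y, n)) 1 1; rewrite feltD feltN !mxE.
apply: contraTneq isT => a1; move: h2; rewrite a1 => h2.
have := normcD (1 - g (x, y, n) 1 1) (g (x, y, n) 1 1).
by rewrite subrK normc1; lra.
Qed.

Lemma projP_neq0 : projP R != 0.
Proof.
by apply: contraTneq isT => /(congr1 mxtrace)/eqP; rewrite tr_projP mxtrace0 oner_eq0.
Qed.

Lemma projQ_neq0 n : projQ R n != 0.
Proof.
by apply: contraTneq isT => /(congr1 mxtrace)/eqP; rewrite tr_projQ mxtrace0 oner_eq0.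
Qed.

Hypothesis free : forall (CX : X -> set Y) (CY : Y -> set X),
  (forall x, countable (CX x)) -> (forall y, countable (CY y)) ->
  exists x y, ~ CX x y /\ ~ CY y x.

Lemma alg_not_almost_unital : ~ almost_unital A.
Proof.
move=> [F [FP [F0 dirF] dF]].
(* The pair holds a member of [F] and its unit; density supplies an element of that member at
   distance less than 1 from [p]. *)
have near (p : A) : exists Bu : set A * A, [/\ F Bu.1, Bu.1 Bu.2,
    forall b, Bu.1 b -> Bu.2 ** b = b & exists2 b, Bu.1 b & rnorm (p - b) < 1].
  have [|b [pb [B FB Bb]]] := dF (ball p (1%:C)) _ (ball_open _ _).
    by exists p; apply: ballxx; rewrite ltcR.
  have [_ [u Bu uB]] := FP B FB.
  exists (B, u); split=> // [c /uB []//|]; exists b => //.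
  by move: pb; rewrite ball_supn.
have [bx hx] := choice (fun x => near (erow x)).
have [byy hy] := choice (fun y => near (ecol y)).
have [x [y [nx ny]]] := free
  (fun x => row_line_countable (bx x).2 x) (fun y => col_line_countable (byy y).2 y).
have [Fx Bux ux [b Bb bd]] := hx x; have [Fy Buy uy [c Bc cd]] := hy y.
(* The unit [d] of [D] fixes both chosen units, which over (x, y, n) turn out to be [projP] and
   [projQ n]. The index [n] is taken where the lower right entry of [d] is not 1. *)
have [D [FD xD yD]] := dirF _ _ Fx Fy.
have [_ [d Dd dD]] := FP D FD.
have [n] := corner_vanishes d x y; case/eqP.
have rP : row_proj x (x, y, n) = projP R by rewrite /row_proj asboolT.
have cQ : col_proj y (x, y, n) = projQ R n by rewrite /col_proj asboolT.
have uP : (bx x).2 (x, y, n) = projP R.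
  apply: (@unit_on_line _ (b (x, y, n))); [exact: projPP|exact: projP_neq0| | |].
  - exact: (on_line nx).
  - by have /(congr1 (fun h : A => h (x, y, n))) := ux _ Bb.
  - rewrite -rP; apply: le_lt_trans bd.
    exact: (opn_le_supn (erow x - b) (x, y, n)).
have uQ : (byy y).2 (x, y, n) = projQ R n.
  apply: (@unit_on_line _ (c (x, y, n))); [exact: projQQ|exact: projQ_neq0| | |].
  - exact: (on_line ny).
  - by have /(congr1 (fun h : A => h (x, y, n))) := uy _ Bc.
  - rewrite -cQ; apply: le_lt_trans cd.
    exact: (opn_le_supn (ecol y - c) (x, y, n)).
apply: (@projPQ_upper _ _ n).
- have /(congr1 (fun h : A => h (x, y, n))) := (dD _ (xD _ Bux)).1.
  by rewrite -uP.
- have /(congr1 (fun h : A => h (x, y, n))) := (dD _ (yD _ Buy)).1.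
  by rewrite -uQ.
Qed.

End Lines.

Theorem theorem1p9 (R : realType) :
  exists A : cstarAlgType R,
    [/\ scattered A, ~ almost_unital A & ~ approx_finite_dimensional A].
Proof.
(* With [Y] the sets of naturals and [X] the power set of [Y * nat], Cantor's theorem excludes an
   injection of [X] into [Y * nat]. *)
pose A : cstarAlgType R := felt (alg_funalg R (set (set nat * nat)) (set nat)).
have nAU : ~ almost_unital A by apply: alg_not_almost_unital; exact: free_pair.
exists A; split=> //; first exact: alg_scattered.
(* The same family serves, since finite-dimensional subalgebras are unital. *)
move=> [F [FP dirF dF]]; apply: nAU; exists F; split=> // B FB.
have [Bsub Bfd] := FP B FB.
by split=> //; apply: finite_dimensional_unital.
Qed.
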